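(* Let $n\ge 2$, let $a=(a_1,\dots,a_n)\in\mathbb{R}^n$ and $b=(b_1,\dots,b_n)\in\mathbb{R}^n$ be constant vectors with $|a|\neq 0$ and $|b|\neq 0$, and let $c\in\mathbb{R}$. Let $u:\mathbb{R}^n\to\mathbb{R}$ be a smooth strictly convex solution of $$\det D^2u=\exp\left\{-\sum_{i=1}^n a_i\frac{\partial u}{\partial x_i}+\sum_{i=1}^n b_ix_i+c\right\}\qquad\text{on } \mathbb{R}^n .$$ Suppose that there exists an orthogonal $n\times n$ matrix $A$ such that $l_A\ge 3$ and $u(Ax)=u(x)$ for each $x\in\mathbb{R}^n$. If the smallest eigenvalue $\mu(x)$ of $D^2u(x)$ satisfies $$\liminf_{x\to\infty}|x|\,\mu(x)>\frac{n-1}{|a|\cos\frac{\pi}{l_A}},$$ then $u$ must be a quadratic polynomial.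
   Context: For a real $n\times n$ matrix $A$, set $\Lambda=\{l\in\mathbb{Z}^+ : A^l=I,\ A^{l-1}\neq I\}$ and $l_A=\min_{l\in\Lambda} l$, where $I$ is the identity matrix; the hypothesis $l_A\ge 3$ includes that $\Lambda$ is nonempty. The notation $x\to\infty$ means $|x|\to\infty$. $D^2u$ denotes the Hessian matrix of $u$; strictly convex means that $D^2u$ is positive definite everywhere. *)

(* Defs.v *)
From mathcomp Require Import all_boot all_order all_algebra.
From mathcomp Require Import all_classical all_reals all_analysis.
Set Implicit Arguments.
Unset Strict Implicit.
Unset Printing Implicit Defensive.
Import Order.TTheory GRing.Theory Num.Theory.
Import numFieldNormedType.Exports.
Local Open Scope classical_set_scope.
Local Open Scope ring_scope.

Section Euclidean.
Context {R : realType} {n : nat}.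
Implicit Types (x y : 'cV[R]_n) (M : 'M[R]_n).

Definition dotv x y : R := \sum_(i < n) x i ord0 * y i ord0.

(* The library norm `|x| on matrices is the sup norm, hence this one. *)
Definition enorm x : R := Num.sqrt (\sum_(i < n) x i ord0 ^+ 2).

(* The filter of neighbourhoods of infinity, i.e. of |x| --> +oo. *)
Definition at_infinity : set_system 'cV[R]_n :=
  [set P | exists r : R, forall x, r < enorm x -> P x].

Definition basis_vec (i : 'I_n) : 'cV[R]_n := delta_mx i ord0.

Definition partial (i : 'I_n) (f : 'cV[R]_n -> R) : 'cV[R]_n -> R :=
  fun x => 'D_(basis_vec i) f x.

Fixpoint iter_partial (s : seq 'I_n) (f : 'cV[R]_n -> R) : 'cV[R]_n -> R :=
  if s is i :: s' then partial i (iter_partial s' f) else f.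

(* The operator 'D_v is total, so the existence of the partial derivatives of
   every order has to be required separately from their continuity. *)
Definition smooth (f : 'cV[R]_n -> R) : Prop :=
  forall s : seq 'I_n,
    continuous (iter_partial s f) /\
    forall (i : 'I_n) (x : 'cV[R]_n), derivable (iter_partial s f) x (basis_vec i).

Definition hessian (f : 'cV[R]_n -> R) x : 'M[R]_n :=
  \matrix_(i < n, j < n) partial i (partial j f) x.

Definition posdefmx M : Prop :=
  forall v : 'cV[R]_n, v != 0 -> 0 < (v^T *m M *m v) ord0 ord0.

Definition strictly_convex (f : 'cV[R]_n -> R) : Prop :=
  forall x, posdefmx (hessian f x).

Definition is_smallest_eigenvalue M (m : R) : Prop :=
  eigenvalue M m /\ forall l : R, eigenvalue M l -> m <= l.

Definition orthogonal_matrix M : Prop := M^T *m M = 1%:M.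

Definition Lambda M : set nat :=
  [set l | [/\ (0 < l)%N, M ^+ l = 1%:M & M ^+ l.-1 <> 1%:M]].

(* l = l_M; in particular Lambda M is nonempty. *)
Definition is_lmin M (l : nat) : Prop :=
  Lambda M l /\ forall k : nat, Lambda M k -> (l <= k)%N.

(* Degree exactly two: for a symmetric Q, the quadratic part vanishes
   identically only if Q = 0. *)
Definition quadratic_polynomial (f : 'cV[R]_n -> R) : Prop :=
  exists (Q : 'M[R]_n) (p : 'cV[R]_n) (r : R),
    [/\ Q^T = Q, Q != 0 &
        forall x, f x = (x^T *m Q *m x) ord0 ord0 + dotv p x + r].

End Euclidean.

(* Main.v *)
Require Import Defs.
From HB Require Import structures.
From mathcomp Require Import all_boot all_order all_algebra.
From mathcomp Require Import all_classical all_reals all_analysis.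
From mathcomp Require Import perm ring lra.
Import Order.TTheory GRing.Theory Num.Theory.
Import numFieldNormedType.Exports.
Local Open Scope classical_set_scope.
Local Open Scope ring_scope.
Set Implicit Arguments.
Unset Strict Implicit.
Unset Printing Implicit Defensive.

(** The growth hypothesis gives a bound [D^2 u >= (k / r) I] on [|x| <= r] for large [r].
Write [H = D^2 u], [L f = tr (H^-1 D^2 f) + a . D f], and let
[T x] be the maximum over [e] of [D^3 u (e,e,e) / H(e,e)^(3/2)], the norm of the cubic
form of the Hessian metric [H]. As in Calabi's work on affine spheres, the equation
gives [L T >= T^3 / 4] at a maximum in [(x, e)]. Since [H^-1 <= (r / k) I],
comparison with the cutoff [r^2 - |x|^2] yields [(r^2 - |x|^2)^2 T^2 <= C r^3] on the
ball of radius [r]; hence [T = 0] as [r] tends to infinity, so all third derivatives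
[D^3 u (e,e,e)] vanish and [u] is quadratic. *)

(** * Functions with continuous partial derivatives *)

(** [T] is a maximum over directions and need not be differentiable, so no differential inequality
    for [T] itself is stated. The square of cutoff times cubic form, divided by [H(e,e)^3], is
    maximized jointly over point and direction, and the inequality is read off smooth curves through
    the maximum along which both may move. The equation enters through the derivatives of log det
    [H] along a line: [b.x + c] is affine, so from the second derivative on only the drift [a.D] is
    left. The first-order condition in the direction [a] then removes the drift at the cost of one
    term in [x.a]. The powers of [r] balance as follows. With [H >= k / r], the derivatives of the
    cutoff cost [r^2 (r / k)] and the drift costs [r^2 r], both of order [r^3]; at a fixed [x] the
    left side is of order [r^4 T^2]. *)

Lemma is_derive_line (R : realType) (V : normedModType R) (f : V -> R) (x v : V) (s : R) :
  derivable f (x + s *: v) v ->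
  is_derive s 1 (fun t : R => f (x + t *: v)) ('D_v f (x + s *: v)).
Proof.
move=> df.
have E : (fun h : R => h^-1 *: (((fun t : R => f (x + t *: v)) \o shift s) (h *: 1)
            - f (x + s *: v)))
       = (fun h => h^-1 *: ((f \o shift (x + s *: v)) (h *: v) - f (x + s *: v))).
  apply/funext => h /=; congr (_ *: (f _ - _)).
  by rewrite scaler1 scalerDl addrCA.
by apply: DeriveDef; [rewrite /derivable E|rewrite /derive E].
Qed.

Lemma mean_value_along (R : realType) (V : normedModType R) (f : V -> R) (x v : V) (k : R) :
  (forall y, derivable f y v) ->
  exists2 t, `|t| <= `|k| & f (x + k *: v) - f x = k * 'D_v f (x + t *: v).
Proof.
move=> df.
pose g t := f (x + t *: v); pose dg t := 'D_v f (x + t *: v).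
have dgP (t : R) : is_derive t (1 : R) g (dg t) by exact: is_derive_line.
have cg (a b : R) : {within `[a, b], continuous g}.
  apply: continuous_subspaceT => t; apply: differentiable_continuous.
  by apply/derivable1_diffP; exact: (@ex_derive _ _ _ _ _ _ _ (dgP t)).
have [k0|k0] := leP 0 k.
  have [t tI E] := MVT_segment k0 (fun t _ => dgP t) (cg 0 k).
  exists t; first by move: tI; rewrite in_itv/= => /andP[t0 tk]; rewrite !ger0_norm.
  by move: E; rewrite /g /dg scale0r addr0 subr0 mulrC.
have [t tI E] := MVT_segment (ltW k0) (fun t _ => dgP t) (cg k 0).
exists t; first by move: tI; rewrite in_itv/= => /andP[tk t0];
  rewrite ler0_norm// ltr0_norm// lerN2.
move: E; rewrite /g /dg scale0r addr0 sub0r => E.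
by rewrite -opprB E mulrN opprK mulrC.
Qed.

Section C1.
Context {R : realType} {n : nat}.
Implicit Types (f : 'cV[R]_n -> R) (x v : 'cV[R]_n) (c : 'I_n -> R) (s : seq 'I_n).

Let lin c s : 'cV[R]_n := \sum_(i <- s) c i *: basis_vec i.

(** The coordinates change one at a time. By the mean value theorem each increment is governed by a
    partial derivative at a point near [x], which continuity compares with its value at [x]. *)
Lemma strictly_differentiable f x c s :
  (forall i y, derivable f y (basis_vec i)) -> (forall i, continuous (partial i f)) ->
  forall e, 0 < e -> exists2 d, 0 < d & forall y h, `|y - x| < d -> `|h| < d ->
    `|f (y + h *: lin c s) - f y - h * \sum_(i <- s) c i * partial i f x| <= e * `|h|.
Proof.
move=> df cf; elim: s => [|i s IH] e e0.
  exists 1 => // y h _ _.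
  by rewrite /lin !big_nil scaler0 addr0 subrr mulr0 subrr normr0 mulr_ge0// ltW.
have e20 : 0 < e / 2 by rewrite divr_gt0.
have [d1 d10 H1] := IH _ e20.
have ec0 : 0 < e / 2 / (1 + `|c i|) by rewrite divr_gt0// ltr_pwDl.
have /cvgrPdist_lt/(_ _ ec0) := cf i x.
move/nbhs_ballP => [d2 /= d20 H2].
(* [K] times the larger of the norms of [y - x] and [h] bounds the distance from [x] to the
   intermediate point [z] below. *)
pose K := 1 + `|lin c s| + `|c i| * `|basis_vec i : 'cV[R]_n|.
have K1 : 1 <= K by rewrite /K -addrA lerDl addr_ge0// mulr_ge0.
have K0 : 0 < K by exact: lt_le_trans K1.
exists (Num.min d1 (d2 / K)); first by rewrite lt_min d10 divr_gt0.
move=> y h; rewrite !lt_min => /andP[yd1 yd2] /andP[hd1 hd2].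
have [t ht Ht] := mean_value_along (y + h *: lin c s) (h * c i) (df i).
rewrite /lin !big_cons -/(lin c s).
have -> : y + h *: (c i *: basis_vec i + lin c s)
        = y + h *: lin c s + (h * c i) *: basis_vec i.
  by rewrite scalerDr scalerA addrA addrAC.
have -> : forall B C D : R, f (y + h *: lin c s + (h * c i) *: basis_vec i) - B
   - h * (C + D) = (f (y + h *: lin c s + (h * c i) *: basis_vec i)
      - f (y + h *: lin c s) - h * C) + (f (y + h *: lin c s) - B - h * D).
  by move=> *; ring.
apply: (le_trans (ler_normD _ _)).
have -> : e * `|h| = e / 2 * `|h| + e / 2 * `|h| by rewrite -mulrDl -splitr.
apply: lerD; last exact: H1.
rewrite Ht mulrA -mulrBr !normrM distrC.
set z := (X in partial i f x - 'D__ f X).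
have zx : `|x - z| < d2.
  rewrite distrC; have -> : z - x = (y - x) + h *: lin c s + t *: basis_vec i.
    by rewrite /z !(addrAC _ (- x)).
  apply: (le_lt_trans (ler_normD _ _)).
  apply: (@le_lt_trans _ _ (Num.max `|y - x| `|h| * K)); last first.
    by rewrite -ltr_pdivlMr// gt_max yd2 hd2.
  have m1 : `|y - x| <= Num.max `|y - x| `|h| by rewrite le_max lexx.
  have m2 : `|h| <= Num.max `|y - x| `|h| by rewrite le_max lexx orbT.
  rewrite /K 2!mulrDr mulr1; apply: lerD.
    apply: (le_trans (ler_normD _ _)); apply: lerD => //.
    by rewrite normrZ ler_wpM2r.
  rewrite normrZ mulrA ler_wpM2r//; apply: (le_trans ht).
  by rewrite normrM ler_wpM2r.
have := H2 z; rewrite -ball_normE /= => /(_ zx) H3.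
have ci : `|c i| < 1 + `|c i| by rewrite ltrDr.
have : `|c i| * `|partial i f x - 'D_(basis_vec i) f z| <= e / 2.
  apply: (@le_trans _ _ ((1 + `|c i|) * (e / 2 / (1 + `|c i|)))).
    by apply: ler_pM => //; exact: ltW.
  by rewrite mulrC divfK// gt_eqF// (le_lt_trans _ ci).
by move=> H4; rewrite -mulrA mulrC ler_wpM2r.
Qed.

(** [smooth] speaks of basis directions only; this gives derivatives in all directions, and their
    linearity in [v]. *)
Lemma is_derive_C1 f x v :
  (forall i y, derivable f y (basis_vec i)) -> (forall i, continuous (partial i f)) ->
  is_derive x v f (\sum_(i < n) v i ord0 * partial i f x).
Proof.
move=> df cf.
have vE : v = \sum_(i <- index_enum 'I_n) v i ord0 *: basis_vec i.
  apply/colP => j; rewrite summxE (bigD1 j)//= big1 => [|i ij].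
    by rewrite !mxE !eqxx mulr1 addr0.
  by rewrite !mxE eq_sym (negbTE ij) mulr0.
have L : (fun h : R => h^-1 *: ((f \o shift x) (h *: v) - f x)) @ 0^'
   --> (\sum_(i < n) v i ord0 * partial i f x).
  apply/cvgrPdist_le => e e0.
  have [d d0 H] := @strictly_differentiable f x (fun i => v i ord0)
     (index_enum 'I_n) df cf e e0.
  have {}H h : `|h| < d -> `|f (x + h *: v) - f x
      - h * \sum_(i < n) v i ord0 * partial i f x| <= e * `|h|.
    by have := H x h; rewrite subrr normr0 => /(_ d0); rewrite /lin/= -vE.
  near=> h.
  have h0 : h != 0 by near: h; exact: nbhs_dnbhs_neq.
  have hd : `|h| < d.
    near: h; apply/nbhs_ballP; exists d => //= z; rewrite -ball_normE/= sub0r normrN.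
    by [].
  rewrite /= [h *: v + x]addrC distrC.
  rewrite -(ler_pM2r (_ : 0 < `|h|)) ?normr_gt0// -normrM mulrBl.
  by rewrite [h^-1 *: _]mulrC divfK// [_ * h]mulrC; exact: H.
by apply: DeriveDef; [apply/cvg_ex; eexists; exact: L|exact: cvg_lim].
Unshelve. all: by end_near. Qed.

End C1.

(** Locked so that expressions with up to five nested derivatives are not unfolded by
    unification. *)
HB.lock Definition dir (R : realType) (n : nat) (v : 'cV[R]_n) (f : 'cV[R]_n -> R) :
  'cV[R]_n -> R := fun x => 'D_v f x.

(** * Calculus of directional derivatives of smooth functions *)

Section Smooth.
Context {R : realType} {n : nat}.
Implicit Types (f g : 'cV[R]_n -> R) (x v w : 'cV[R]_n) (s : R).

Lemma smooth_continuous f : smooth f -> continuous f.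
Proof. by move=> /(_ [::]) []. Qed.

Lemma smooth_partial f i : smooth f -> smooth (partial i f).
Proof.
move=> sf s; have -> : iter_partial s (partial i f) = iter_partial (rcons s i) f.
  by elim: s => //= j s ->.
exact: sf.
Qed.

Lemma smooth_is_derive f x v : smooth f ->
  is_derive x v f (\sum_(i < n) v i ord0 * partial i f x).
Proof.
move=> sf; apply: is_derive_C1; first by move=> i y; have [_ /(_ i y)] := sf [::].
by move=> i; have [] := sf [:: i].
Qed.

Lemma dirE f v x : smooth f -> dir v f x = \sum_(i < n) v i ord0 * partial i f x.
Proof. by move=> sf; rewrite dir.unlock; have [] := smooth_is_derive x v sf. Qed.

Lemma is_derive_dir f v x : smooth f -> is_derive x v f (dir v f x).
Proof. by move=> sf; rewrite dirE//; exact: smooth_is_derive. Qed.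

Lemma smooth_derivable f x v : smooth f -> derivable f x v.
Proof. by move=> sf; have [] := smooth_is_derive x v sf. Qed.

Lemma smooth_cst (k : R) : smooth (fun _ : 'cV[R]_n => k).
Proof.
move=> s; suff [k' k'E] : exists k', iter_partial s (fun=> k) = fun=> k'.
  by rewrite k'E; split=> [|i x]; [exact: cst_continuous|exact: derivable_cst].
elim: s => [|i s [k' /= ->]]; first by exists k.
by exists 0; apply/funext => x; rewrite /partial (derive_cst k').
Qed.

Lemma smooth_scaleD (k : R) f g : smooth f -> smooth g -> smooth (fun x => k * f x + g x).
Proof.
move=> sf sg s.
suff -> : iter_partial s (fun x => k * f x + g x)
        = fun x => k * iter_partial s f x + iter_partial s g x.
  split=> [x|i x].
    exact: (continuousD (continuousM (@cst_continuous _ _ k x) ((sf s).1 x)) ((sg s).1 x)).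
  by apply: derivableD; [apply: derivableZ; exact: (sf s).2|exact: (sg s).2].
elim: s => //= i s ->; apply/funext => x; rewrite /partial.
have df : derivable (iter_partial s f) x (basis_vec i) by exact: (sf s).2.
have dg : derivable (iter_partial s g) x (basis_vec i) by exact: (sg s).2.
by have := deriveD (derivableZ (k := k) df) dg; rewrite deriveZ.
Qed.

Lemma smooth_sum (I : Type) (r : seq I) (F : I -> 'cV[R]_n -> R) (c : I -> R) :
  (forall i, smooth (F i)) -> smooth (fun x => \sum_(i <- r) c i * F i x).
Proof.
move=> sF; elim: r => [|i r IH].
  by under eq_fun do rewrite big_nil; exact: smooth_cst.
by under eq_fun do rewrite big_cons; exact: smooth_scaleD.
Qed.

Lemma smooth_dir f v : smooth f -> smooth (dir v f).
Proof.
move=> sf; rewrite (_ : dir v f = fun x => \sum_(i < n) v i ord0 * partial i f x).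
  by apply: smooth_sum => i; exact: smooth_partial.
by apply/funext => x; exact: dirE.
Qed.

Lemma dir_sumv (I : Type) (r : seq I) (c : I -> R) (v : I -> 'cV[R]_n) f x : smooth f ->
  dir (\sum_(i <- r) c i *: v i) f x = \sum_(i <- r) c i * dir (v i) f x.
Proof.
move=> sf; rewrite dirE//.
under [RHS]eq_bigr do rewrite dirE// mulr_sumr.
rewrite exchange_big; apply: eq_bigr => j _ /=.
by rewrite summxE mulr_suml; apply: eq_bigr => i _; rewrite mxE mulrA.
Qed.

Lemma dirDv f v w x : smooth f -> dir (v + w) f x = dir v f x + dir w f x.
Proof.
by move=> sf; rewrite !dirE// -big_split; apply: eq_bigr => i _; rewrite mxE mulrDl.
Qed.

Lemma dirZv f (k : R) v x : smooth f -> dir (k *: v) f x = k * dir v f x.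
Proof.
by move=> sf; rewrite !dirE// mulr_sumr; apply: eq_bigr => i _; rewrite mxE mulrA.
Qed.

Lemma dir_sumf (I : Type) (r : seq I) (c : I -> R) (F : I -> 'cV[R]_n -> R) v x :
  (forall i, smooth (F i)) ->
  dir v (fun x => \sum_(i <- r) c i * F i x) x = \sum_(i <- r) c i * dir v (F i) x.
Proof.
move=> sF; elim: r => [|i r IH].
  by under eq_fun do rewrite big_nil; rewrite big_nil dir.unlock (derive_cst (0 : R)).
under eq_fun do rewrite big_cons; rewrite big_cons -IH dir.unlock.
have d1 := @smooth_derivable _ x v (sF i).
have d2 := @smooth_derivable _ x v (@smooth_sum _ r F c sF).
by have := deriveD (derivableZ (k := c i) d1) d2; rewrite deriveZ.
Qed.

(** The mean value theorem is used twice, along [v] on the increment in [w], then along [w]. The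
    left side is symmetric in [v] and [w], which is what [dirC] exploits. *)
Let second_difference f x v w (h : R) : smooth f ->
  exists2 y, `|y - x| <= `|h| * (`|v| + `|w|) &
    f (x + h *: v + h *: w) - f (x + h *: v) - (f (x + h *: w) - f x)
    = h * (h * dir w (dir v f) y).
Proof.
move=> sf; pose g y := f (y + h *: w) - f y.
have dg y : is_derive y v g (dir v f (y + h *: w) - dir v f y).
  apply: is_deriveB; last exact: is_derive_dir.
  have : is_derive (y + h *: w) v f (dir v f (y + h *: w)).
    exact: is_derive_dir.
  have E : (fun k : R => k^-1 *: ((f \o shift (y + h *: w)) (k *: v) - f (y + h *: w)))
    = (fun k => k^-1 *: (((fun z => f (z + h *: w)) \o shift y) (k *: v) - f (y + h *: w))).
    by apply/funext => k /=; rewrite addrA.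
  by case=> d1 d2; apply: DeriveDef; [rewrite /derivable -E|rewrite -d2 /derive -E].
have [t th Et] := @mean_value_along R _ g x v h (fun y => @ex_derive _ _ _ _ _ _ _ (dg y)).
have [t' t'h Et'] := @mean_value_along R _ (dir v f) (x + t *: v) w h
  (fun y => @smooth_derivable _ y w (smooth_dir v sf)).
exists (x + t *: v + t' *: w).
  rewrite -(addrA x) (addrC x) addrK (le_trans (ler_normD _ _))// mulrDr !normrZ.
  by apply: lerD; rewrite ler_wpM2r.
rewrite -[LHS]/(g (x + h *: v) - g x) Et (@derive_val _ _ _ _ _ _ _ (dg _)).
congr (_ * _).
by rewrite Et' dir.unlock.
Qed.

(** Reading the second difference in both orders gives equal mixed derivatives at two points [y1]
    and [y2] close to [x]; continuity carries the equality to [x]. *)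
Lemma dirC f v w x : smooth f -> dir v (dir w f) x = dir w (dir v f) x.
Proof.
move=> sf; apply/eqP; rewrite -subr_eq0 -normr_le0; apply/ler_addgt0Pl => e e0.
rewrite addr0.
have e20 : 0 < e / 2 by rewrite divr_gt0.
have cvw : continuous (dir v (dir w f)) by apply/smooth_continuous/smooth_dir/smooth_dir.
have cwv : continuous (dir w (dir v f)) by apply/smooth_continuous/smooth_dir/smooth_dir.
have /cvgrPdist_lt/(_ _ e20)/nbhs_ballP[d1 /= d10 H1] := cvw x.
have /cvgrPdist_lt/(_ _ e20)/nbhs_ballP[d2 /= d20 H2] := cwv x.
pose K := 1 + `|v| + `|w|; have K0 : 0 < K by rewrite /K -addrA ltr_pwDl.
pose h := Num.min d1 d2 / 2 / K.
have h0 : 0 < h by rewrite !divr_gt0// lt_min d10.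
have hK : h * (`|v| + `|w|) < Num.min d1 d2.
  apply: (@le_lt_trans _ _ (h * K)).
    by rewrite ler_wpM2l ?(ltW h0)// /K -addrA lerDr.
  by rewrite /h divfK ?gt_eqF// ltr_pdivrMr// ltr_pMr ?ltr1n// lt_min d10.
have [y1 y1x E1] := second_difference x v w h sf.
have [y2 y2x E2] := second_difference x w v h sf.
rewrite gtr0_norm// in y1x y2x.
have E : dir w (dir v f) y1 = dir v (dir w f) y2.
  have hn : h != 0 by rewrite gt_eqF.
  apply: (mulfI hn); apply: (mulfI hn); 
  apply: (etrans (esym E1) (etrans _ E2)); rewrite [x + h *: w + _]addrAC.
  by move: (f _) (f _) (f _) (f _) => p q r t; ring.
have := H1 y2; have := H2 y1; rewrite -!ball_normE/= ![`|x - _|]distrC E.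
have y1d : `|y1 - x| < d2.
  by apply: (le_lt_trans y1x (lt_le_trans hK _)); rewrite ge_min lexx orbT.
have y2d : `|y2 - x| < d1.
  rewrite [`|w| + _]addrC in y2x; apply: (le_lt_trans y2x (lt_le_trans hK _)).
  by rewrite ge_min lexx.
move=> /(_ y1d) B1 /(_ y2d) B2.
apply: (le_trans (ler_distD (dir v (dir w f) y2) _ _)).
by rewrite (splitr e); apply: lerD; [exact: ltW B2|rewrite distrC; exact: ltW B1].
Qed.

Lemma smoothZ (k : R) f : smooth f -> smooth (fun x => k * f x).
Proof.
move=> sf; have := smooth_scaleD k sf (smooth_cst 0).
by congr smooth; apply/funext => x; rewrite addr0.
Qed.

Lemma dir_scaleD (k : R) f g v x : smooth f -> smooth g ->
  dir v (fun x => k * f x + g x) x = k * dir v f x + dir v g x.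
Proof.
move=> sf sg; have := deriveD (derivableZ (k := k) (@smooth_derivable _ x v sf))
    (@smooth_derivable _ x v sg).
by rewrite dir.unlock deriveZ//; exact: smooth_derivable.
Qed.

Lemma dirZf (k : R) f v x : smooth f -> dir v (fun x => k * f x) x = k * dir v f x.
Proof.
move=> sf; have := dir_scaleD k v x sf (smooth_cst 0).
have -> : dir v (fun=> 0 : R) x = 0 by rewrite dir.unlock (derive_cst (0 : R)).
by rewrite addr0 => <-; congr (dir _ _ _); apply/funext => y; rewrite addr0.
Qed.

Lemma dirD_fun f v w s : smooth f ->
  dir (v + s *: w) f = fun y => s * dir w f y + dir v f y.
Proof. by move=> sf; apply/funext => y; rewrite dirDv// dirZv// addrC. Qed.

Lemma dir_commute f v w : smooth f -> dir v (dir w f) = dir w (dir v f).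
Proof. by move=> sf; apply/funext => x; exact: dirC. Qed.

Lemma dir0v f x : dir 0 f x = 0.
Proof. by rewrite dir.unlock derive0. Qed.

Lemma is_derive_dir_line f x v s : smooth f ->
  is_derive s (1 : R) (fun s => f (x + s *: v)) (dir v f (x + s *: v)).
Proof. by move=> sf; rewrite dir.unlock; exact/is_derive_line/smooth_derivable. Qed.

End Smooth.

(** * Derivatives of matrix curves *)

Section Curves.
Context {R : realType}.
Implicit Types (f g : R -> R) (s : R).

Lemma is_deriveD_fun f g s (df dg : R) : is_derive s 1 f df -> is_derive s 1 g dg ->
  is_derive s 1 (fun t => f t + g t) (df + dg).
Proof. by move=> ? ?; exact: is_deriveD. Qed.

Lemma is_deriveM_fun f g s (df dg : R) : is_derive s 1 f df -> is_derive s 1 g dg ->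
  is_derive s 1 (fun t => f t * g t) (df * g s + f s * dg).
Proof.
by move=> ? ?; apply: is_derive_eq (is_deriveM _ _) _; rewrite addrC [g s *: _]mulrC.
Qed.

Lemma is_derive_bigsum (I : Type) (r : seq I) (F : I -> R -> R) (dF : I -> R) s :
  (forall i, is_derive s 1 (F i) (dF i)) ->
  is_derive s 1 (fun t => \sum_(i <- r) F i t) (\sum_(i <- r) dF i).
Proof.
move=> H; elim: r => [|i r IH].
  by under eq_fun do rewrite big_nil; rewrite big_nil; exact: is_derive_cst.
by under eq_fun do rewrite big_cons; rewrite big_cons; exact: is_deriveD_fun.
Qed.

Lemma is_derive_bigprod m (F : 'I_m -> R -> R) (dF : 'I_m -> R) s :
  (forall i, is_derive s 1 (F i) (dF i)) ->
  is_derive s 1 (fun t => \prod_(i < m) F i t)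
    (\sum_(k < m) \prod_(i < m) (if i == k then dF i else F i s)).
Proof.
elim: m F dF => [|m IH] F dF H.
  by under eq_fun do rewrite big_ord0; rewrite big_ord0; exact: is_derive_cst.
under eq_fun do rewrite big_ord_recl.
apply: is_derive_eq (is_deriveM_fun (H ord0) (IH _ _ (fun i => H (lift ord0 i)))) _.
rewrite [RHS]big_ord_recl; congr (_ + _); first by rewrite big_ord_recl eqxx.
by rewrite mulr_sumr; apply: eq_bigr => k _; rewrite big_ord_recl.
Qed.

Definition mx_deriv m p (F F' : R -> 'M[R]_(m, p)) :=
  forall s i j, is_derive s (1 : R) (fun t => F t i j) (F' s i j).

Lemma mx_derivM m p q (F F' : R -> 'M[R]_(m, p)) (G G' : R -> 'M[R]_(p, q)) :
  mx_deriv F F' -> mx_deriv G G' ->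
  mx_deriv (fun s => F s *m G s) (fun s => F' s *m G s + F s *m G' s).
Proof.
move=> dF dG s i j; under eq_fun do rewrite mxE.
rewrite !mxE -big_split; apply: is_derive_bigsum => k.
exact: is_deriveM_fun.
Qed.

Lemma is_derive_mxtrace m (F F' : R -> 'M[R]_m) s : mx_deriv F F' ->
  is_derive s 1 (fun t => \tr (F t)) (\tr (F' s)).
Proof. by move=> dF; exact: is_derive_bigsum. Qed.

(** Jacobi's formula. Differentiating the Leibniz sum replaces one row at a time by its derivative,
    and expansion along that row produces the adjugate. *)
Lemma is_derive_det m (F F' : R -> 'M[R]_m) s : mx_deriv F F' ->
  is_derive s 1 (fun t => \det (F t)) (\tr (\adj (F s) *m F' s)).
Proof.
move=> dF.
pose B k := \matrix_(i, j) (if i == k then F' s i j else F s i j).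
have H : is_derive s (1 : R) (fun t => \det (F t)) (\sum_(k < m) \det (B k)).
  rewrite exchange_big /=; apply: is_derive_bigsum => sg.
  rewrite -mulr_sumr.
  have := is_derive_bigprod (fun i => dF s i ((sg : 'S_m) i)).
  move=> /(is_deriveM_fun (is_derive_cst ((-1) ^+ sg : R) s 1)).
  rewrite mul0r add0r => H; apply: is_derive_eq H _; congr (_ * _).
  by apply: eq_bigr => k _; apply: eq_bigr => i _; rewrite mxE.
apply: is_derive_eq H _; rewrite /mxtrace.
under [RHS]eq_bigr do rewrite mxE.
rewrite [RHS]exchange_big; apply: eq_bigr => k _ /=.
rewrite (expand_det_row _ k); apply: eq_bigr => j _.
rewrite mxE eqxx mulrC [(\adj _) _ _]mxE; congr (_ * _).
rewrite /cofactor; congr (_ * \det _); apply/matrixP => i l.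
by rewrite !mxE eq_sym (negbTE (neq_lift _ _)).
Qed.

(** Differentiability comes from the cofactor formula; the value then follows by differentiating
    [invmx (F s) *m F s = 1]. *)
Lemma mx_deriv_inv m (F F' : R -> 'M[R]_m) :
  (forall s, \det (F s) != 0) -> mx_deriv F F' ->
  mx_deriv (fun s => invmx (F s)) (fun s => - (invmx (F s) *m F' s *m invmx (F s))).
Proof.
move=> F0 dF.
have uF s : F s \in unitmx by rewrite unitmxE unitfE.
have [K dK] : exists K, mx_deriv (fun s => invmx (F s)) K.
  suff dK s i j : derivable (fun t => invmx (F t) i j) s (1 : R).
    exists (fun s => \matrix_(i, j) 'D_1 (fun t => invmx (F t) i j) s) => s i j.
    by rewrite mxE; apply: derivableP.
  under eq_fun do rewrite /invmx uF !mxE.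
  have d1 : derivable (fun t => (\det (F t))^-1) s (1 : R).
    apply: derivableV => //; exact: (@ex_derive _ _ _ _ _ _ _ (is_derive_det s dF)).
  have d2 : derivable (fun t => cofactor (F t) j i) s (1 : R).
    have dR : mx_deriv (fun t => row' j (col' i (F t))) (fun t => row' j (col' i (F' t))).
      by move=> t k l; under eq_fun do rewrite !mxE; rewrite !mxE.
    apply: derivableM; first exact: derivable_cst.
    exact: (@ex_derive _ _ _ _ _ _ _ (is_derive_det s dR)).
  exact: derivableM.
suff <- : K = (fun s => - (invmx (F s) *m F' s *m invmx (F s))) by [].
apply/funext => s.
have dKF := mx_derivM dK dF.
have E : K s *m F s + invmx (F s) *m F' s = 0.
  apply/matrixP => i j; rewrite [RHS]mxE.
  have [_ <-] := dKF s i j.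
  under eq_fun do rewrite mulVmx//.
  exact: derive_cst.
have : (K s *m F s + invmx (F s) *m F' s) *m invmx (F s) = 0 by rewrite E mul0mx.
by rewrite mulmxDl mulmxK// => /eqP; rewrite addr_eq0 => /eqP.
Qed.

Lemma is_derive_unique f s (d d' : R) : is_derive s 1 f d -> is_derive s 1 f d' -> d = d'.
Proof. by move=> [_ <-] [_ <-]. Qed.

(** These are the second and third derivatives of log det [h] without the logarithm: Jacobi's
    formula gives [tr (h^-1 h1) = psi1] once [det h] is cancelled, and two more differentiations are
    evaluated at 0. The factor [k] makes room for the square of the determinant of a change of
    frame. *)
Lemma trace_identities m (h h1 h2 h3 : R -> 'M[R]_m) (psi psi1 psi2 psi3 : R -> R) (k : R) :
  mx_deriv h h1 -> mx_deriv h1 h2 -> mx_deriv h2 h3 ->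
  (forall s, is_derive s (1 : R) psi (psi1 s)) ->
  (forall s, is_derive s (1 : R) psi1 (psi2 s)) ->
  (forall s, is_derive s (1 : R) psi2 (psi3 s)) ->
  k != 0 -> (forall s, \det (h s) = k * expR (psi s)) -> h 0 = 1%:M ->
  \tr (h2 0) - \tr (h1 0 *m h1 0) = psi2 0 /\
  \tr (h3 0) - 3 * \tr (h1 0 *m h2 0) + 2 * \tr (h1 0 *m h1 0 *m h1 0) = psi3 0.
Proof.
move=> dh dh1 dh2 dp dp1 dp2 k0 hE h0.
have det0 s : \det (h s) != 0 by rewrite hE mulf_neq0// gt_eqF// expR_gt0.
have uh s : h s \in unitmx by rewrite unitmxE unitfE.
pose K s := invmx (h s).
have dK : mx_deriv K (fun s => - (K s *m h1 s *m K s)) by exact: mx_deriv_inv.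
have E1 s : \tr (K s *m h1 s) = psi1 s.
  have D1 := is_derive_det s dh.
  have D2 : is_derive s (1 : R) (fun t => \det (h t)) (\det (h s) * psi1 s).
    under eq_fun do rewrite hE.
    rewrite hE; apply: is_derive_eq (is_deriveM_fun (is_derive_cst k s 1)
      (is_derive1_comp (is_derive_expR (psi s)) (dp s))) _.
    by rewrite mul0r add0r mulrA.
  have := is_derive_unique D1 D2.
  have -> : \adj (h s) = \det (h s) *: K s.
    by rewrite /K /invmx uh scalerA divff// scale1r.
  by rewrite -scalemxAl mxtraceZ => /(mulfI (det0 s)).
pose G s := K s *m h1 s; pose G2 s := K s *m h2 s.
have dG : mx_deriv G (fun s => G2 s - G s *m G s).
  have := mx_derivM dK dh1; congr mx_deriv; apply/funext => s.
  by rewrite addrC mulNmx /G !mulmxA.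
have dG2 : mx_deriv G2 (fun s => K s *m h3 s - G s *m G2 s).
  have := mx_derivM dK dh2; congr mx_deriv; apply/funext => s.
  by rewrite addrC mulNmx /G /G2 !mulmxA.
have dGG := mx_derivM dG dG.
have E2 s : \tr (G2 s) - \tr (G s *m G s) = psi2 s.
  rewrite -raddfB /=; apply: is_derive_unique (is_derive_mxtrace s dG) _.
  by under eq_fun do rewrite E1.
have E3 s : \tr (K s *m h3 s - G s *m G2 s)
    - \tr ((G2 s - G s *m G s) *m G s + G s *m (G2 s - G s *m G s)) = psi3 s.
  have := is_deriveB (is_derive_mxtrace s dG2) (is_derive_mxtrace s dGG).
  move/is_derive_unique; apply.
  rewrite (_ : _ - _ = psi2)//; apply/funext => t; exact: E2.
have K0 : K 0 = 1%:M by rewrite /K h0 invmx1.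
split; first by have := E2 0; rewrite /G2 /G K0 !mul1mx.
have := E3 0; rewrite /G2 /G K0 !mul1mx mulmxBl mulmxBr.
rewrite !(raddfB, raddfD)/= (mxtrace_mulC (h2 0)) mulmxA => <-.
move: (\tr _) (\tr _) (\tr _) => x y z; ring.
Qed.

End Curves.

(** Symmetric elimination: [L] clears the first row and column off the diagonal, and the Schur
    complement [S'] inherits symmetry and positivity. *)
Lemma posdefmx_normalize (R : realType) m (S : 'M[R]_m) : S^T = S -> posdefmx S ->
  exists P : 'M[R]_m, P^T *m S *m P = 1%:M.
Proof.
elim: m S => [|m IH] S ST Spos; first by exists 1%:M; apply/matrixP => -[].
move: S ST Spos; rewrite -[m.+1]/(1 + m)%N => S ST Spos.
pose a := S ord0 ord0.
have aE : ulsubmx S = a%:M.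
  rewrite [LHS]mx11_scalar mxE mxE; congr (S _ _)%:M; exact/val_inj.
have a0 : 0 < a.
  have := Spos (col_mx 1%:M 0); rewrite -[X in _ *m X *m _]submxK tr_col_mx.
  rewrite mul_row_block mul_row_col aE !trmx1 !trmx0 !(mul0mx, mulmx0, addr0, mul1mx, mulmx1).
  rewrite mxE eqxx mulr1n; apply; apply/eqP => /(congr1 usubmx).
  rewrite col_mxKu => /matrixP/(_ ord0 ord0); rewrite !mxE => /eqP; by rewrite oner_eq0.
pose w := ursubmx S.
have wT : dlsubmx S = w^T by rewrite /w trmx_ursub ST.
pose L : 'M[R]_(1 + m) := block_mx 1%:M (- a^-1 *: w) 0 1%:M.
pose S' := drsubmx S - a^-1 *: (w^T *m w).
have LSL : L^T *m S *m L = block_mx a%:M 0 0 S'.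
  rewrite -[S in LHS]submxK aE wT -/w /L tr_block_mx !mulmx_block !trmx1 trmx0.
  rewrite !(mul0mx, mulmx0, addr0, add0r, mul1mx, mulmx1).
  congr block_mx.
  - by rewrite -scalemxAr mul_scalar_mx scalerA mulNr mulVf ?gt_eqF// scaleN1r addNr.
  - rewrite [(_ *: w)^T]linearZ /= -scalemxAl mul_mx_scalar scalerA mulNr mulVf ?gt_eqF//.
    by rewrite scaleN1r addNr.
  rewrite [(_ *: w)^T]linearZ /= -!scalemxAl mul_mx_scalar scalerA mulNr mulVf ?gt_eqF//.
  by rewrite scaleN1r addNr mul0mx add0r /S' addrC scaleNr.
have S'pos : posdefmx S'.
  move=> v v0; have E : L *m col_mx 0 v = col_mx (- a^-1 *: w *m v) v.
    by rewrite /L mul_block_col !(mulmx0, mul0mx, mul1mx, add0r).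
  have := Spos (L *m col_mx 0 v); rewrite {1}E col_mx_eq0 (negbTE v0) andbF => /(_ isT).
  rewrite trmx_mul !mulmxA -(mulmxA _ L^T) -(mulmxA _ (L^T *m S)) LSL.
  rewrite tr_col_mx mul_row_block mul_row_col.
  by rewrite !(trmx0, mul0mx, mulmx0, add0r, addr0).
have S'T : S'^T = S'.
  rewrite /S' linearB linearZ /= trmx_mul trmxK; congr (_ - _).
  by rewrite trmx_drsub ST.
have [Q QSQ] := IH _ S'T S'pos.
pose r := (Num.sqrt a)^-1.
exists (L *m block_mx r%:M 0 0 Q).
rewrite trmx_mul !mulmxA -(mulmxA _ L^T) -(mulmxA _ (L^T *m S)) LSL.
rewrite tr_block_mx !mulmx_block !trmx0 tr_scalar_mx.
rewrite !(mul0mx, mulmx0, addr0, add0r) QSQ -!scalar_mxM.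
rewrite [X in block_mx X%:M](_ : _ = 1) -?scalar_mx_block//.
rewrite /r -{2}(sqr_sqrtr (ltW a0)) expr2 mulrA mulVf ?mul1r ?mulfV//;
  by rewrite gt_eqF// sqrtr_gt0.
Qed.

(** * Curves through a maximum point *)

(** If [f2 < 0], then [f1] is negative just to the right of 0, and the mean value theorem pushes [f]
    below [f 0]. *)
Lemma second_derivative_test (R : realType) (f f1 : R -> R) (f2 d : R) :
  (forall s, is_derive s (1 : R) f (f1 s)) -> is_derive (0 : R) (1 : R) f1 f2 ->
  0 < d -> (forall s, `|s| < d -> f 0 <= f s) -> f1 0 = 0 /\ 0 <= f2.
Proof.
move=> df df1 d0 fmin.
have f10 : f1 0 = 0.
  have dd : - d <= d by lra.
  have H : is_derive (0 : R) (1 : R) f 0.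
    apply: (derive1_at_min dd) => [t _||t]; first exact: (@ex_derive _ _ _ _ _ _ _ (df t)).
      by rewrite in_itv/= oppr_lt0 d0.
    by rewrite in_itv/= -ltr_norml => /fmin.
  exact: is_derive_unique (df 0) H.
split=> //; rewrite leNgt; apply/negP => f20.
have [d1 d2] := df1.
have L : (fun h : R => h^-1 *: ((f1 \o shift 0) (h *: 1) - f1 0)) @ 0^' --> f2.
  by rewrite -d2; exact: d1.
have n20 : 0 < - f2 by rewrite oppr_gt0.
move/cvgrPdist_lt : L => /(_ _ n20).
rewrite near_withinE => /nbhs_ballP[r /= r0 Hr].
pose s := Num.min d r / 2.
have m0 : 0 < Num.min d r by rewrite lt_min d0.
have s0 : 0 < s by rewrite divr_gt0.
have sm : s < Num.min d r by rewrite ltr_pdivrMr// ltr_pMr ?ltr1n.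
have sd : s < d by apply: (lt_le_trans sm); rewrite ge_min lexx.
have sr : s < r by apply: (lt_le_trans sm); rewrite ge_min lexx orbT.
have cf : {within `[0, s], continuous f}.
  apply: continuous_subspaceT => t; apply: differentiable_continuous.
  by apply/derivable1_diffP; exact: (@ex_derive _ _ _ _ _ _ _ (df t)).
have [c] := MVT s0 (fun t _ => df t) cf.
rewrite in_itv/= => /andP[c0 cs] E.
have : f 0 <= f s by apply: fmin; rewrite gtr0_norm.
rewrite -subr_ge0 E subr0 pmulr_lge0// leNgt => /negP; apply.
have := Hr c; rewrite -ball_normE/= sub0r normrN gtr0_norm// => /(_ (lt_trans cs sr)).
rewrite gt_eqF// => /(_ isT); rewrite /= addr0 scaler1 f10 subr0 => H.
have {}H : `|f2 - c^-1 * f1 c| < - f2 by exact: H.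
have H1 : c^-1 * f1 c < 0.
  by move: H; rewrite ltr_norml => /andP[H _]; move: H; rewrite opprK ltrBrDl -ltrBrDr subrr.
by rewrite -(pmulr_rlt0 _ (_ : 0 < c^-1)) ?invr_gt0.
Qed.

Section Variation.
Context {R : realType}.

(** Near 0, [2 log p - 3 log q] is maximal at 0. The test is applied to [l q^3 - p^2], which has
    minimum 0 there and involves no quotient. Inserting the first-order value of [p1] leaves
    [6 - 9/2 = 3/2] times [p^2 q1^2], whence the 3/4. *)
Lemma cube_ratio_max (p p1 q q1 : R -> R) (p2 q2 l d : R) :
  (forall s, is_derive s (1 : R) p (p1 s)) -> is_derive (0 : R) (1 : R) p1 p2 ->
  (forall s, is_derive s (1 : R) q (q1 s)) -> is_derive (0 : R) (1 : R) q1 q2 ->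
  0 < d -> (forall s, `|s| < d -> p s ^+ 2 <= l * q s ^+ 3) ->
  p 0 ^+ 2 = l -> q 0 = 1 -> 0 < p 0 ->
  p1 0 = 3 / 2 * p 0 * q1 0 /\ p2 <= p 0 * (3 / 2 * q2 + 3 / 4 * q1 0 ^+ 2).
Proof.
move=> dp dp1 dq dq1 d0 H pl q01 p0.
pose f s := l * (q s * q s * q s) + (- 1) * (p s * p s).
pose f1 s := l * (q1 s * (q s * q s)) * 3 + (- 2) * (p s * p1 s).
have df s : is_derive s (1 : R) f (f1 s).
  apply: is_derive_eq (is_deriveD_fun (is_deriveM_fun (is_derive_cst l s 1)
    (is_deriveM_fun (is_deriveM_fun (dq s) (dq s)) (dq s)))
    (is_deriveM_fun (is_derive_cst (- 1 : R) s 1) (is_deriveM_fun (dp s) (dp s)))) _.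
  by rewrite /f1 /cst; ring.
pose f2 := l * 3 * (q2 + 2 * q1 0 ^+ 2) - 2 * (p1 0 ^+ 2 + p 0 * p2).
have df1 : is_derive (0 : R) (1 : R) f1 f2.
  apply: is_derive_eq (is_deriveD_fun (is_deriveM_fun (is_deriveM_fun
    (is_derive_cst l (0 : R) (1 : R))
    (is_deriveM_fun dq1 (is_deriveM_fun (dq 0) (dq 0)))) (is_derive_cst (3 : R) (0 : R) (1 : R)))
    (is_deriveM_fun (is_derive_cst (- 2 : R) (0 : R) (1 : R)) (is_deriveM_fun (dp 0) dp1))) _.
  by rewrite /f2 /cst q01; ring.
have [|e1 e2] := second_derivative_test df df1 d0.
  move=> s /H H1; rewrite /f q01 -pl.
  have -> : p 0 ^+ 2 * (1 * 1 * 1) + -1 * (p 0 * p 0) = 0 by ring.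
  move: H1; rewrite -pl; lra.
have E1 : p1 0 = 3 / 2 * p 0 * q1 0.
  apply: (mulfI (_ : p 0 != 0)); first by rewrite gt_eqF.
  by move: e1; rewrite /f1 q01 -pl => e1; lra.
split=> //; rewrite -(ler_pM2l p0).
move: e2; rewrite /f2 E1 -pl; lra.
Qed.

(** A second or third derivative of [u] in the moving direction [e + s b] is a polynomial in [s] of
    degree at most 3 whose coefficients are functions at the moving point. This Horner shape is
    stable under differentiation ([G]), so it is differentiated twice; [u3] has no effect at order
    two. *)
Lemma is_derive_cubic_curve n (u0 u1 u2 u3 : 'cV[R]_n -> R) (x v : 'cV[R]_n) :
  smooth u0 -> smooth u1 -> smooth u2 -> smooth u3 ->
  exists g1 : R -> R,
  [/\ forall s, is_derive s (1 : R) (fun s => u0 (x + s *: v) + s * (u1 (x + s *: v)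
        + s * (u2 (x + s *: v) + s * u3 (x + s *: v)))) (g1 s),
      g1 0 = dir v u0 x + u1 x &
      is_derive (0 : R) (1 : R) g1 (dir v (dir v u0) x + 2 * dir v u1 x + 2 * u2 x)].
Proof.
move=> s0 s1 s2 s3.
have L := fun (f : 'cV[R]_n -> R) s => @is_derive_dir_line R n f x v s.
have I s : is_derive s (1 : R) (fun t : R => t) 1 by exact: is_derive_id.
have G f0 f1 f2 f3 s : smooth f0 -> smooth f1 -> smooth f2 -> smooth f3 ->
  is_derive s (1 : R) (fun s => f0 (x + s *: v) + s * (f1 (x + s *: v)
        + s * (f2 (x + s *: v) + s * f3 (x + s *: v))))
   (dir v f0 (x + s *: v) + (f1 (x + s *: v) + s * (f2 (x + s *: v) + s * f3 (x + s *: v))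
      + s * (dir v f1 (x + s *: v) + (f2 (x + s *: v) + s * f3 (x + s *: v) +
         s * (dir v f2 (x + s *: v) + (f3 (x + s *: v) + s * dir v f3 (x + s *: v))))))).
  move=> ? ? ? ?.
  apply: is_derive_eq (is_deriveD_fun (L _ s _) (is_deriveM_fun (I s) (is_deriveD_fun (L _ s _)
     (is_deriveM_fun (I s) (is_deriveD_fun (L _ s _) (is_deriveM_fun (I s) (L _ s _))))))) _ => //.
  by rewrite !mul1r.
have S (k : R) (f g : 'cV[R]_n -> R) :
    smooth f -> smooth g -> smooth (fun y => k * f y + g y) by exact: smooth_scaleD.
pose F0 y := 1 * dir v u0 y + u1 y.
pose F1 y := 2 * u2 y + dir v u1 y.
pose F2 y := 3 * u3 y + dir v u2 y.
have SD (f : 'cV[R]_n -> R) : smooth f -> smooth (dir v f) by exact: smooth_dir.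
have sF0 : smooth F0 by exact: (S _ _ _ (SD _ s0) s1).
have sF1 : smooth F1 by exact: (S _ _ _ s2 (SD _ s1)).
have sF2 : smooth F2 by exact: (S _ _ _ s3 (SD _ s2)).
exists (fun s => F0 (x + s *: v) + s * (F1 (x + s *: v)
        + s * (F2 (x + s *: v) + s * dir v u3 (x + s *: v)))); split.
- move=> s; apply: is_derive_eq (G _ _ _ _ s s0 s1 s2 s3) _; rewrite /F0 /F1 /F2; ring.
- by rewrite scale0r addr0 mul0r addr0 /F0 mul1r.
apply: is_derive_eq (G _ _ _ _ 0 sF0 sF1 sF2 (SD _ s3)) _.
rewrite scale0r addr0 !mul0r !addr0 /F0 /F1 (dir_scaleD 1 v x (SD _ s0) s1).
ring.
Qed.

End Variation.

(** * First and second variation of the localized ratio *)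

Section MaximumPoint.
Context {R : realType} {n : nat}.
Implicit Types (f : 'cV[R]_n -> R) (x y v w e : 'cV[R]_n) (s : R).

Lemma dir_line_scaleD (k : R) f g e b s y : smooth f -> smooth g ->
  dir (e + s *: b) (fun x => k * f x + g x) y =
  k * (s * dir b f y + dir e f y) + (s * dir b g y + dir e g y).
Proof.
move=> sf sg; rewrite (dir_scaleD k _ y sf sg).
by rewrite (dirD_fun e b s sf) (dirD_fun e b s sg).
Qed.

(** The term [s * 0] pads the quadratic expansion to the cubic Horner shape, so that
    [is_derive_cubic_curve] serves both expansions. *)
Lemma dir2_expand u e b s y : smooth u ->
  dir (e + s *: b) (dir (e + s *: b) u) y =
  dir e (dir e u) y + s * (2 * dir b (dir e u) y + s * (dir b (dir b u) y + s * 0)).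
Proof.
move=> su; have Sb := smooth_dir b su; have Se := smooth_dir e su.
rewrite (dirD_fun e b s su) (dir_line_scaleD s e b s y Sb Se).
by rewrite (dirC e b y su); ring.
Qed.

Lemma dir3_expand u e b s y : smooth u ->
  dir (e + s *: b) (dir (e + s *: b) (dir (e + s *: b) u)) y =
  dir e (dir e (dir e u)) y + s * (3 * dir b (dir e (dir e u)) y
    + s * (3 * dir b (dir b (dir e u)) y + s * dir b (dir b (dir b u)) y)).
Proof.
move=> su; have Sb := smooth_dir b su; have Se := smooth_dir e su.
have Sbb := smooth_dir b Sb; have Sbe := smooth_dir b Se; have See := smooth_dir e Se.
have -> : dir (e + s *: b) (dir (e + s *: b) u) = fun z =>
    s * (s * dir b (dir b u) z + 2 * dir b (dir e u) z) + dir e (dir e u) z.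
  by apply/funext => z; rewrite (dir2_expand e b s z su); ring.
rewrite (dir_line_scaleD s e b s y (smooth_scaleD s Sbb (smoothZ 2 Sbe)) See).
rewrite (dir_scaleD s b y Sbb (smoothZ 2 Sbe)) (dir_scaleD s e y Sbb (smoothZ 2 Sbe)).
rewrite (dirZf 2 b y Sbe) (dirZf 2 e y Sbe).
rewrite (dirC e b y Sb) (dir_commute e b su) (dirC e b y Se).
ring.
Qed.

Definition cutoff (r : R) x : R := r ^+ 2 - dotv x x.

Lemma cutoff_line (r : R) x v s :
  cutoff r (x + s *: v) = cutoff r x + s * (- 2 * dotv x v + s * - dotv v v).
Proof.
rewrite /cutoff (_ : dotv (x + s *: v) (x + s *: v) =
   dotv x x + 2 * s * dotv x v + s ^+ 2 * dotv v v); first by ring.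
rewrite /dotv !mulr_sumr -!big_split /=; apply: eq_bigr => i _; rewrite !mxE; ring.
Qed.

Lemma dotvr0 x : dotv x 0 = 0.
Proof. by rewrite /dotv big1// => i _; rewrite mxE mulr0. Qed.

(* The test curve is [s |-> (x0 + s v, e + s b)]. *)
Lemma max_variation u (r d l t : R) x0 e v b : smooth u ->
  0 < d -> (forall y w, `|y - x0| < d ->
    (cutoff r y * dir w (dir w (dir w u)) y) ^+ 2 <= l * dir w (dir w u) y ^+ 3) ->
  dir e (dir e u) x0 = 1 -> t = dir e (dir e (dir e u)) x0 -> 0 < t ->
  0 < cutoff r x0 -> l = (cutoff r x0 * t) ^+ 2 ->
  let c1 := dir v (dir e (dir e (dir e u))) x0 + 3 * dir b (dir e (dir e u)) x0 in
  let c2 := dir v (dir v (dir e (dir e (dir e u)))) x0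
    + 6 * dir v (dir b (dir e (dir e u))) x0 + 6 * dir b (dir b (dir e u)) x0 in
  let q1 := dir v (dir e (dir e u)) x0 + 2 * dir b (dir e u) x0 in
  let q2 := dir v (dir v (dir e (dir e u))) x0 + 4 * dir v (dir b (dir e u)) x0
    + 2 * dir b (dir b u) x0 in
  - 2 * dotv x0 v * t + cutoff r x0 * c1 = 3 / 2 * (cutoff r x0 * t) * q1 /\
  - 2 * dotv v v * t + 2 * (- 2 * dotv x0 v) * c1 + cutoff r x0 * c2
    <= cutoff r x0 * t * (3 / 2 * q2 + 3 / 4 * q1 ^+ 2).
Proof.
move=> su d0 Hmax H1 tE t0 r0 lE c1 c2 q1 q2.
have Sb := smooth_dir b su; have Se := smooth_dir e su.
have Sbb := smooth_dir b Sb; have Sbe := smooth_dir b Se; have See := smooth_dir e Se.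
have [qd [dq q10 dq1]] := is_derive_cubic_curve x0 v See (smoothZ 2 Sbe) Sbb (smooth_cst 0).
have [cd [dc c10 dc1]] := is_derive_cubic_curve x0 v (smooth_dir e See)
  (smoothZ 3 (smooth_dir b See)) (smoothZ 3 (smooth_dir b Sbe)) (smooth_dir b Sbb).
pose q s := dir (e + s *: b) (dir (e + s *: b) u) (x0 + s *: v).
pose c s := dir (e + s *: b) (dir (e + s *: b) (dir (e + s *: b) u)) (x0 + s *: v).
pose rho s := cutoff r x0 + s * (- 2 * dotv x0 v + s * - dotv v v).
pose rho1 s := - 2 * dotv x0 v + 2 * s * - dotv v v.
have I s : is_derive s (1 : R) (fun t : R => t) 1 by exact: is_derive_id.
have K (k : R) s : is_derive s (1 : R) (fun _ : R => k) 0 by exact: is_derive_cst.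
have dq' s : is_derive s (1 : R) q (qd s).
  move: (dq s); congr (is_derive _ _ _ _); apply/funext => z.
  by rewrite /q dir2_expand.
have dc' s : is_derive s (1 : R) c (cd s).
  move: (dc s); congr (is_derive _ _ _ _); apply/funext => z.
  by rewrite /c dir3_expand.
have drho s : is_derive s (1 : R) rho (rho1 s).
  apply: is_derive_eq (is_deriveD_fun (K (cutoff r x0) s) (is_deriveM_fun (I s)
   (is_deriveD_fun (K (- 2 * dotv x0 v) s) (is_deriveM_fun (I s) (K (- dotv v v) s))))) _.
  rewrite /rho1; ring.
have drho1 : is_derive (0 : R) (1 : R) rho1 (- 2 * dotv v v).
  apply: is_derive_eq (is_deriveD_fun (K (- 2 * dotv x0 v) 0) (is_deriveM_fun
    (is_deriveM_fun (K 2 0) (I 0)) (K (- dotv v v) 0))) _; ring.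
have dp s := is_deriveM_fun (drho s) (dc' s).
have dp1 := is_deriveD_fun (is_deriveM_fun drho1 (dc' 0)) (is_deriveM_fun (drho 0) dc1).
(* For such [s] the displacement [s v] has norm below [d]; the summand 1 covers [v = 0]. *)
have d'0 : 0 < d / (1 + `|v|) by rewrite divr_gt0// ltr_pwDl.
have Hpq s : `|s| < d / (1 + `|v|) -> (rho s * c s) ^+ 2 <= l * q s ^+ 3.
  move=> sd; rewrite /rho -cutoff_line; apply: Hmax.
  rewrite addrC addKr normrZ; move: sd; rewrite ltr_pdivlMr ?ltr_pwDl//.
  by apply: le_lt_trans; rewrite ler_wpM2l// lerDr.
have c0 : c 0 = t by rewrite /c !scale0r !addr0 tE.
have q0 : q 0 = 1 by rewrite /q !scale0r !addr0.
have rho0 : rho 0 = cutoff r x0 by rewrite /rho mul0r addr0.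
have rho10 : rho1 0 = - 2 * dotv x0 v by rewrite /rho1 mulr0 mul0r addr0.
have [] := cube_ratio_max dp dp1 dq' dq1 d'0 Hpq.
- by rewrite rho0 c0 lE.
- exact: q0.
- by rewrite rho0 c0 mulr_gt0.
rewrite rho0 c0 rho10 q10 c10 (dirZf 2 v x0 Sbe) (dirZf 3 v x0 (smooth_dir b See)).
rewrite -/q1 -/c1 => E1 E2; split; first by [].
move: E2; congr (_ <= _).
  rewrite /c2; ring.
rewrite /q2; ring.
Qed.

End MaximumPoint.

(** * The equation in an orthonormal frame *)

Section CalabiInequality.
Context {R : realType} {n : nat}.
Implicit Types (f : 'cV[R]_n -> R) (x y v w e : 'cV[R]_n) (s : R).

Lemma dir_hessian u x m p (P : 'M[R]_(n, m)) (Q : 'M[R]_(n, p)) i j : smooth u ->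
  (P^T *m hessian u x *m Q) i j = dir (col i P) (dir (col j Q) u) x.
Proof.
move=> su; have -> : dir (col j Q) u = fun y => \sum_l col j Q l ord0 * partial l u y.
  by apply/funext => y; exact: dirE.
rewrite dir_sumf => [|l]; last exact: smooth_partial.
rewrite mxE; apply: eq_bigr => l _.
rewrite dirE; last exact: smooth_partial.
rewrite !mxE mulrC; congr (_ * _); apply: eq_bigr => k _; by rewrite !mxE.
Qed.

Section Frame.
Context (u : 'cV[R]_n -> R) (a b : 'cV[R]_n) (c : R) (x0 e : 'cV[R]_n) (P : 'M[R]_n)
  (su : smooth u)
  (u_sol : forall x, \det (hessian u x) = expR (- dir a u x + dotv b x + c))
  (PHP : P^T *m hessian u x0 *m P = 1%:M).

Let v i := col i P.
Let M i j := dir (v i) (dir (v j) (dir e u)) x0.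
Let N i j := dir (v i) (dir (v j) (dir e (dir e u))) x0.

Lemma frame_orthonormal i j : dir (v i) (dir (v j) u) x0 = (i == j)%:R.
Proof. by rewrite -(dir_hessian x0 P P i j su) PHP mxE. Qed.

(** For square matrices [P^T H P = 1] also gives [P (P^T H) = 1], the expansion in an
    [H]-orthonormal basis. *)
Lemma frame_expand : e = \sum_i dir (v i) (dir e u) x0 *: v i.
Proof.
have PPH : P *m (P^T *m hessian u x0) = 1%:M by rewrite (mulmx1C PHP).
rewrite -{1}[e]mul1mx -PPH -mulmxA; apply/colP => k.
rewrite mxE summxE; apply: eq_bigr => i _.
by rewrite dir_hessian// mxE [v i _ _]mxE mulrC col_id.
Qed.

(** The frame stays fixed while the equation is differentiated along [x0 + s e]; thus [M] and [N]
    are the first and second [e]-derivatives of the Hessian in that frame. *)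
Lemma frame_traces :
  \sum_i N i i + dir a (dir e (dir e u)) x0 = \sum_i \sum_j M i j ^+ 2 /\
  \sum_i dir (v i) (dir (v i) (dir e (dir e (dir e u)))) x0
      + dir a (dir e (dir e (dir e u))) x0 =
    3 * (\sum_i \sum_j M i j * N i j) - 2 * (\sum_i \sum_j \sum_k M i j * M i k * M j k).
Proof.
have SD w f : smooth f -> smooth (dir w f) by exact: smooth_dir.
have MC i j : M i j = M j i by exact: (dirC _ _ _ (SD _ _ su)).
have NC i j : N i j = N j i by exact: (dirC _ _ _ (SD _ _ (SD _ _ su))).
pose h f s := \matrix_(i, j) dir (v i) (dir (v j) f) (x0 + s *: e).
have dh f : smooth f -> mx_deriv (h f) (h (dir e f)).
  move=> sf s i j; under eq_fun do rewrite mxE.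
  rewrite mxE (dir_commute (v j) e sf) (dir_commute (v i) e (SD _ _ sf)).
  exact: (is_derive_dir_line _ _ _ (SD _ _ (SD _ _ sf))).
pose psi s := - dir a u (x0 + s *: e) + dotv b (x0 + s *: e) + c.
pose psi1 s := - dir e (dir a u) (x0 + s *: e) + dotv b e.
have dpsi s : is_derive s (1 : R) psi (psi1 s).
  have -> : psi = fun s => - dir a u (x0 + s *: e) + (s * dotv b e + (dotv b x0 + c)).
    apply/funext => z; rewrite /psi -addrA; congr (_ + _).
    rewrite addrA; congr (_ + _); rewrite /dotv mulr_sumr -big_split /=.
    by apply: eq_bigr => i _; rewrite !mxE; ring.
  have I : is_derive s (1 : R) (fun t : R => t) 1 by exact: is_derive_id.
  have K (k : R) : is_derive s (1 : R) (fun _ : R => k) 0 by exact: is_derive_cst.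
  apply: is_derive_eq (is_deriveD_fun (is_deriveN (is_derive_dir_line x0 e s (SD a _ su)))
    (is_deriveD_fun (is_deriveM_fun I (K (dotv b e))) (K _))) _.
  by rewrite /psi1 mulr0 !addr0 mul1r.
have dpsi1 s : is_derive s (1 : R) psi1 (- dir e (dir e (dir a u)) (x0 + s *: e)).
  have K (k : R) : is_derive s (1 : R) (fun _ : R => k) 0 by exact: is_derive_cst.
  apply: is_derive_eq (is_deriveD_fun (is_deriveN (is_derive_dir_line x0 e s (SD e _ (SD a _ su))))
    (K (dotv b e))) _; by rewrite addr0.
have dpsi2 s : is_derive s (1 : R) (fun s => - dir e (dir e (dir a u)) (x0 + s *: e))
    (- dir e (dir e (dir e (dir a u))) (x0 + s *: e)).
  exact: is_deriveN (is_derive_dir_line x0 e s (SD e _ (SD e _ (SD a _ su)))).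
have hE s : h u s = P^T *m hessian u (x0 + s *: e) *m P.
  by apply/matrixP => i j; rewrite dir_hessian// mxE.
have detP : \det P ^+ 2 != 0.
  have := congr1 determinant PHP; rewrite !det_mulmx det_tr det1 => E.
  by apply: contra_eq_neq E => /eqP; rewrite sqrf_eq0 => /eqP ->; rewrite mulr0 eq_sym oner_eq0.
have [] := trace_identities (dh _ su) (dh _ (SD e _ su)) (dh _ (SD e _ (SD e _ su)))
  dpsi dpsi1 dpsi2 detP.
- by move=> s; rewrite hE !det_mulmx det_tr u_sol -/(psi s); ring.
- by rewrite hE scale0r addr0.
rewrite scale0r addr0 => E2 E3; split.
  move: E2; rewrite (dir_commute e a su) (dirC e a _ (SD e _ su)).
  rewrite /mxtrace; under eq_bigr do rewrite mxE scale0r addr0.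
  rewrite [X in _ - X](_ : _ = \sum_i \sum_j M i j ^+ 2); first by move=> E2; lra.
  apply: eq_bigr => i _; rewrite mxE; apply: eq_bigr => j _.
  by rewrite !mxE scale0r addr0 expr2 -/(M i j) -/(M j i) MC.
move: E3; rewrite (dir_commute e a su) (dir_commute e a (SD e _ su)).
rewrite (dirC e a _ (SD e _ (SD e _ su))).
rewrite /mxtrace; under eq_bigr do rewrite mxE scale0r addr0.
rewrite [X in _ - 3 * X](_ : _ = \sum_i \sum_j M i j * N i j); last first.
  apply: eq_bigr => i _; rewrite mxE; apply: eq_bigr => j _.
  by rewrite !mxE scale0r addr0 -/(N j i) NC.
rewrite [X in 2 * X](_ : _ = \sum_i \sum_j \sum_k M i j * M i k * M j k); last first.
  apply: eq_bigr => i _; rewrite mxE exchange_big; apply: eq_bigr => k _ /=.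
  rewrite mxE mulr_suml; apply: eq_bigr => j _.
  by rewrite !mxE scale0r addr0 -/(M i j) -/(M j k) -/(M k i) (MC k i); ring.
lra.
Qed.

End Frame.

End CalabiInequality.

(** Summing the second variations over the frame turns the fifth derivatives into a trace that the
    equation expresses by lower ones. With [X] the cutoff, [S2 = tr M^2] and [S3 = tr M^3], what
    remains is [X^2 (3/4 t S2 - 1/2 S3)] against cutoff and drift terms. Then [S3 <= t S2] and
    [t^2 <= S2] bound it below by [X^2 t^3 / 4], and [t] is divided out. *)
Lemma max_point_estimate (R : realType) (n : nat) (u : 'cV[R]_n -> R) (a b : 'cV[R]_n) (c : R)
    (x0 e : 'cV[R]_n) (P : 'M[R]_n) (r d l t : R) :
  smooth u ->
  (forall x, \det (hessian u x) = expR (- dir a u x + dotv b x + c)) ->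
  P^T *m hessian u x0 *m P = 1%:M ->
  (forall w, 0 <= dir w (dir w u) x0) ->
  0 < d -> (forall y w, `|y - x0| < d ->
    (cutoff r y * dir w (dir w (dir w u)) y) ^+ 2 <= l * dir w (dir w u) y ^+ 3) ->
  dir e (dir e u) x0 = 1 -> t = dir e (dir e (dir e u)) x0 -> 0 < t ->
  0 < cutoff r x0 -> l = (cutoff r x0 * t) ^+ 2 ->
  1 / 4 * (cutoff r x0 * t) ^+ 2 <=
    2 * cutoff r x0 * (\sum_i dotv (col i P) (col i P))
    + 8 * (\sum_i dotv x0 (col i P) ^+ 2) + 2 * cutoff r x0 * dotv x0 a.
Proof.
move=> su u_sol PHP H0 d0 Hmax H1 tE t0 r0 lE.
set X := cutoff r x0.
have var v w := @max_variation R n u r d l t x0 e v w su d0 Hmax H1 tE t0 r0 lE.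
have SD (w : 'cV[R]_n) (f : 'cV[R]_n -> R) : smooth f -> smooth (dir w f)
  by exact: smooth_dir.
have Se := SD e _ su; have See := SD e _ Se;
pose v i := col i P.
pose M i j := dir (v i) (dir (v j) (dir e u)) x0.
pose N i j := dir (v i) (dir (v j) (dir e (dir e u))) x0.
pose ep i := dir (v i) (dir e u) x0.
have Xt0 : 0 < X * t by rewrite mulr_gt0.
have fo := frame_orthonormal su PHP.
have eE : e = \sum_i ep i *: v i := frame_expand e su PHP.
(* Only the direction moves: [e] is critical for the cubic form on the unit sphere of [H], so
   [D^3 u(e,e,w) = t H(e,w)]. *)
have ev w : dir w (dir e (dir e u)) x0 = t * dir w (dir e u) x0.
  have [+ _] := var 0 w; rewrite dotvr0 !dir0v => E.
  apply: (mulfI (lt0r_neq0 r0)); move: E; rewrite -/X; lra.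
(* Cauchy-Schwarz for [H], tested on [w] minus its [H]-projection to the unit vector [e]. *)
have cs w : dir w (dir e u) x0 ^+ 2 <= dir w (dir w u) x0.
  have := H0 (w + (- dir w (dir e u) x0) *: e).
  by rewrite (dir2_expand w e _ x0 su) H1 (dirC e w x0 su) => ?; lra.
(* The second variation in the direction alone: no eigenvalue of [M] exceeds [t]. *)
have ew w : dir w (dir w (dir e u)) x0 <= t * dir w (dir w u) x0.
  have [_] := var 0 w; rewrite !dotvr0 !dir0v => E.
  have cw : X * t * dir w (dir e u) x0 ^+ 2 <= X * t * dir w (dir w u) x0.
    by rewrite ler_pM2l.
  rewrite -(ler_pM2l r0).
  move: E; rewrite -/X; lra.
(* First-order parallel transport of [e] along [v i] for the Levi-Civita connection of the
   Hessian metric, whose Christoffel symbols are half the third derivatives: it makes the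
   first variation of [H(e,e)] vanish and cancels the terms in [M i j * N i j]. *)
pose B i := \sum_j (- 1 / 2 * M i j) *: v j.
have Me i : dir (v i) (dir e (dir e u)) x0 = \sum_j ep j * M i j.
  rewrite (dirC (v i) e x0 Se) {1}eE (dir_sumv _ _ _ _ (SD _ _ Se)).
  by apply: eq_bigr => j _; rewrite (dirC (v j) (v i) x0 Se).
have Be i : dir (B i) (dir e u) x0 = - 1 / 2 * (t * ep i).
  rewrite (dir_sumv _ _ _ _ Se) -ev Me mulr_sumr; apply: eq_bigr => j _.
  by rewrite -/(ep j); ring.
have BB i : dir (B i) (dir (B i) u) x0 = 1 / 4 * \sum_j M i j ^+ 2.
  rewrite (dir_sumv _ _ _ _ (SD _ _ su)) mulr_sumr; apply: eq_bigr => j _.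
  rewrite (dirC _ _ _ su) (dir_sumv _ _ _ _ (SD _ _ su)) (bigD1 j)//= big1 => [|k kj].
    by rewrite fo eqxx /=; field.
  by rewrite fo (negbTE kj) mulr0.
have BBe i : dir (B i) (dir (B i) (dir e u)) x0
    = 1 / 4 * \sum_j \sum_k M i j * M i k * M j k.
  rewrite (dir_sumv _ _ _ _ (SD _ _ Se)) mulr_sumr; apply: eq_bigr => j _.
  rewrite (dirC _ _ _ Se) (dir_sumv _ _ _ _ (SD _ _ Se)) !mulr_sumr; apply: eq_bigr => k _.
  by rewrite (dirC _ _ _ Se) -/(M j k); field.
have vBe i : dir (v i) (dir (B i) (dir e u)) x0 = - 1 / 2 * \sum_j M i j ^+ 2.
  rewrite (dirC _ _ _ Se) (dir_sumv _ _ _ _ (SD _ _ Se)) mulr_sumr; apply: eq_bigr => j _.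
  by rewrite (dirC _ _ _ Se) -/(M i j); ring.
have vBee i : dir (v i) (dir (B i) (dir e (dir e u))) x0 = - 1 / 2 * \sum_j M i j * N i j.
  rewrite (dirC _ _ _ See) (dir_sumv _ _ _ _ (SD _ _ See)) mulr_sumr; apply: eq_bigr => j _.
  by rewrite (dirC _ _ _ See) -/(N i j); ring.
have vi i := var (v i) (B i).
pose c1 i := dir (v i) (dir e (dir e (dir e u))) x0 + 3 * dir (B i) (dir e (dir e u)) x0.
have c1E i : X * c1 i = 2 * dotv x0 (v i) * t.
  have [+ _] := vi i; rewrite -/(c1 i) -/X (ev (v i)) -/(ep i) Be => E; lra.
pose w3 i := dir (v i) (dir (v i) (dir e (dir e (dir e u)))) x0.
have ineq i : - 2 * X * t * dotv (v i) (v i) - 8 * t * dotv x0 (v i) ^+ 2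
   + X ^+ 2 * (w3 i - 3 * (\sum_j M i j * N i j) + 3 / 2 * (\sum_j \sum_k M i j * M i k * M j k))
   <= X ^+ 2 * t * (3 / 2 * N i i - 9 / 4 * \sum_j M i j ^+ 2).
  have [_] := vi i; rewrite -/(c1 i) -/X (ev (v i)) -/(ep i) Be vBee BBe vBe BB -/(w3 i) -/(N i i).
  move=> E; have {}E := ler_wpM2l (ltW r0) E; rewrite -/X in E.
  (* The cross term between cutoff and cubic form becomes a square through [c1E]; the factors 4 and
     2 make up the 8 of the estimate. *)
  have E1 : X * (2 * (-2 * dotv x0 (v i)) * c1 i) = - 8 * t * dotv x0 (v i) ^+ 2.
    by transitivity (- 4 * dotv x0 (v i) * (X * c1 i)); [ring|rewrite c1E; ring].
  lra.
(* [B i] is a multiple of the [i]-th row of [M]. Applying [cs] and [ew] to it and summing over [i]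
   gives the bounds on [tr M^2] and [tr M^3] without diagonalizing [M]. *)
have low i : t ^+ 2 * ep i ^+ 2 <= \sum_j M i j ^+ 2.
  have := cs (B i); rewrite Be BB; lra.
have cub i : \sum_j \sum_k M i j * M i k * M j k <= t * \sum_j M i j ^+ 2.
  have := ew (B i); rewrite BBe BB; lra.
have ep1 : \sum_i ep i ^+ 2 = 1.
  rewrite -H1 {1}eE (dir_sumv _ _ _ _ Se); by apply: eq_bigr => i _; rewrite expr2.
pose S2 := \sum_i \sum_j M i j ^+ 2.
pose S3 := \sum_i \sum_j \sum_k M i j * M i k * M j k.
have lowS : t ^+ 2 <= S2.
  by rewrite -[leLHS]mulr1 -ep1 mulr_sumr; apply: ler_sum => i _.
have cubS : S3 <= t * S2 by rewrite /S2 mulr_sumr; apply: ler_sum => i _.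
have [tr2 tr3] := @frame_traces R n u a b c x0 e P su u_sol PHP.
(* The point moves along [a] with the direction fixed. This trades the drift of the cubic form for
   that of [H(e,e)], which cancels against the drift in [Nc]. *)
have av : dir a (dir e (dir e (dir e u))) x0 * X = 2 * dotv x0 a * t
    + 3 / 2 * X * t * dir a (dir e (dir e u)) x0.
  have [+ _] := var a 0; rewrite !dir0v -/X => E; lra.
have tot : - 2 * X * t * (\sum_i dotv (v i) (v i)) - 8 * t * (\sum_i dotv x0 (v i) ^+ 2)
   + X ^+ 2 * (\sum_i w3 i - 3 * (\sum_i \sum_j M i j * N i j) + 3 / 2 * S3)
   <= X ^+ 2 * t * (3 / 2 * (\sum_i N i i) - 9 / 4 * S2).
  have := ler_sum (P := xpredT) (index_enum 'I_n) (fun i _ => ineq i).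
  by rewrite !(big_split, sumrN, =^~ mulr_sumr) /=.
rewrite -(ler_pM2l t0).
have k1 := ler_wpM2l (sqr_ge0 X) cubS.
have k2 : X ^+ 2 * t * t ^+ 2 <= X ^+ 2 * t * S2.
  by rewrite ler_wpM2l// mulr_ge0 ?sqr_ge0// ltW.
have Wc : \sum_i w3 i = 3 * (\sum_i \sum_j M i j * N i j) - 2 * S3
   - dir a (dir e (dir e (dir e u))) x0 by rewrite -tr3 addrK.
have Nc : \sum_i N i i = S2 - dir a (dir e (dir e u)) x0 by rewrite /S2 -tr2 addrK.
move: tot; rewrite Wc Nc => tot.
have k3 := congr1 (fun z => X * z) av.
lra.
Qed.

(** * Compactness *)

Section Compactness.
Context {R : realType} {n : nat}.
Implicit Types (f : 'cV[R]_n -> R) (x y v w e : 'cV[R]_n) (r : R).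

Lemma continuous_mul (T : topologicalType) (f g : T -> R) :
  continuous f -> continuous g -> continuous (fun t => f t * g t).
Proof. by move=> cf cg t; exact: (continuousM (cf t) (cg t)). Qed.

Lemma continuous_bigsum (T : topologicalType) (I : Type) (s : seq I) (F : I -> T -> R) :
  (forall i, continuous (F i)) -> continuous (fun t => \sum_(i <- s) F i t).
Proof.
move=> cF; elim: s => [|i s IH].
  by under eq_fun do rewrite big_nil; move=> t; exact: cst_continuous.
under eq_fun do rewrite big_cons.
by move=> t; exact: (continuousD (cF i t) (IH t)).
Qed.

Lemma dotv_continuous : continuous (fun x => dotv x x).
Proof.
by apply: continuous_bigsum => i; apply: continuous_mul; exact: coord_continuous.
Qed.

Lemma trmx_continuous m p : continuous (@trmx R m p).
Proof.
move=> x s /nbhs_ballP[e e0 es]; apply/nbhs_ballP; exists e => // y [_ H].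
by apply: es; split=> // i j; rewrite !mxE.
Qed.

(** [bounded_closed_compact] is applied to row vectors, so the set is carried over by
    transposition. *)
Lemma compact_dotv_le r (A : set 'cV[R]_n) :
  closed A -> (forall x, A x -> dotv x x <= r) -> compact A.
Proof.
move=> cA Ar; have -> : A = trmx @` [set y : 'rV[R]_n | A y^T].
  apply/seteqP; split=> [x Ax|_ [y Ay <-]//].
  by exists x^T => /=; rewrite trmxK.
apply: continuous_compact; first by apply: continuous_subspaceT; exact: trmx_continuous.
apply: bounded_closed_compact; last first.
  apply: (@preimage_closed _ _ (@trmx R 1 n) A) => // y _.
  exact: trmx_continuous.
exists (1 + r); split; first exact: num_real.
move=> M rM y /= Ay.
have r0 : 0 <= r.
  apply: le_trans (Ar _ Ay); apply: sumr_ge0 => i _; exact: sqr_ge0.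
have M0 : 0 <= M by lra.
rewrite -[`|y|]/(mx_norm y) mx_normrE; apply/bigmax_leP; split=> // -[i j] _ /=.
rewrite (ord1 i); have : y ord0 j ^+ 2 <= r.
  apply: le_trans (Ar _ Ay); rewrite /dotv (bigD1 j)//= !mxE -expr2 lerDl.
  by apply: sumr_ge0 => k _; exact: sqr_ge0.
rewrite -(real_normK (num_real (y ord0 j))) => H.
rewrite leNgt; apply/negP => My.
have := normr_ge0 (y ord0 j); nra.
Qed.

Lemma dotv_ge0 x : 0 <= dotv x x.
Proof. by apply: sumr_ge0 => i _; exact: sqr_ge0. Qed.

Lemma dotv_gt0 x : x != 0 -> 0 < dotv x x.
Proof.
move=> x0; rewrite lt_def dotv_ge0 andbT; apply: contra_neq x0 => /eqP.
rewrite psumr_eq0 => [/allP H|i _]; last exact: sqr_ge0.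
apply/colP => i; rewrite mxE.
by have := H i; rewrite mem_index_enum => /(_ isT); rewrite mulf_eq0 orbb => /eqP.
Qed.

Lemma iter_dir_sumf k (I : Type) (s : seq I) (c : I -> R) (F : I -> 'cV[R]_n -> R) e :
  (forall i, smooth (F i)) ->
  iter k (dir e) (fun x => \sum_(i <- s) c i * F i x) =
  fun x => \sum_(i <- s) c i * iter k (dir e) (F i) x.
Proof.
elim: k F => // k IH F sF; rewrite iterSr.
have -> : dir e (fun x => \sum_(i <- s) c i * F i x) =
    fun x => \sum_(i <- s) c i * dir e (F i) x by apply/funext => x; exact: dir_sumf.
by rewrite IH => [|i]; [under eq_fun do under eq_bigr do rewrite -iterSr|exact: smooth_dir].
Qed.

(** Continuity is joint in point and direction: expanding in partial derivatives, the direction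
    enters only through its coordinates, and the order drops by one. *)
Lemma iter_dir_continuous k f : smooth f ->
  continuous (fun z : 'cV[R]_n * 'cV[R]_n => iter k (dir z.2) f z.1).
Proof.
elim: k f => [|k IH] f sf /=.
  move=> z; apply: (@continuous_comp _ _ _ fst f); first exact: cvg_fst.
  exact: smooth_continuous.
have E : (fun z : 'cV[R]_n * 'cV[R]_n => iter k.+1 (dir z.2) f z.1) =
  fun z => \sum_(i < n) z.2 i ord0 * iter k (dir z.2) (partial i f) z.1.
  apply/funext => z; rewrite iterSr.
  have -> : dir z.2 f = fun x => \sum_(i < n) z.2 i ord0 * partial i f x.
    by apply/funext => x; exact: dirE.
  by rewrite iter_dir_sumf// => i; exact: smooth_partial.
rewrite [X in continuous X]E; apply: continuous_bigsum => i; apply: continuous_mul; last first.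
  by apply: IH; exact: smooth_partial.
move=> z; apply: (@continuous_comp _ _ _ snd (fun w : 'cV[R]_n => w i ord0)).
  exact: cvg_snd.
exact: coord_continuous.
Qed.

Lemma closed_dotv (D : set R) : closed D -> closed [set x : 'cV[R]_n | D (dotv x x)].
Proof.
by move=> cD; apply: (preimage_closed (f := fun x => dotv x x)) => // x _;
   exact: dotv_continuous.
Qed.

Lemma compact_sphere : compact [set e : 'cV[R]_n | dotv e e = 1].
Proof.
apply: (@compact_dotv_le 1) => [|x /= ->//].
exact: (closed_dotv (@closed_eq _ 1)).
Qed.

Lemma compact_ball_sphere r :
  compact ([set x : 'cV[R]_n | dotv x x <= r] `*` [set e : 'cV[R]_n | dotv e e = 1]).
Proof.
apply: compact_setX; last exact: compact_sphere.
by apply: (@compact_dotv_le r) => //; exact: (closed_dotv (@closed_le _ r)).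
Qed.

End Compactness.

(** * The localized bound on the cubic form *)

Section InteriorEstimate.
Context {R : realType} {n : nat}.
Implicit Types (f : 'cV[R]_n -> R) (x y v w e : 'cV[R]_n) (r : R).

Lemma dotv_comb_sqr x v (p q : R) :
  0 <= p ^+ 2 * dotv x x - 2 * p * q * dotv x v + q ^+ 2 * dotv v v.
Proof.
rewrite (_ : _ + _ = \sum_i (p * x i ord0 - q * v i ord0) ^+ 2).
  by apply: sumr_ge0 => i _; exact: sqr_ge0.
by rewrite /dotv !mulr_sumr -sumrB -big_split /=; apply: eq_bigr => i _; ring.
Qed.

Lemma dotv_cauchy_schwarz x v : dotv x v ^+ 2 <= dotv x x * dotv v v.
Proof.
have [->|v0] := eqVneq v 0.
  by rewrite !dotvr0 expr0n mulr0.
have v0' := dotv_gt0 v0; rewrite -(ler_pM2l v0').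
have := dotv_comb_sqr x v (dotv v v) (dotv x v); lra.
Qed.

Lemma dotv_normalize w : w != 0 -> exists k e, [/\ 0 < k, dotv e e = 1 & w = k *: e].
Proof.
move=> /dotv_gt0 w0; have k0 : 0 < Num.sqrt (dotv w w) by rewrite sqrtr_gt0.
exists (Num.sqrt (dotv w w)), ((Num.sqrt (dotv w w))^-1 *: w); split=> //.
  rewrite /dotv; under eq_bigr do rewrite !mxE mulrACA.
  rewrite -mulr_sumr -/(dotv w w) -invfM -expr2 sqr_sqrtr ?(ltW w0)// mulVf//.
  by rewrite gt_eqF.
by rewrite scalerA mulfV ?scale1r// gt_eqF.
Qed.

Lemma dotvZ (k : R) x : dotv (k *: x) (k *: x) = k ^+ 2 * dotv x x.
Proof. by rewrite /dotv mulr_sumr; apply: eq_bigr => i _; rewrite !mxE mulrACA expr2. Qed.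

Lemma dir2_scale f (k : R) e x : smooth f ->
  dir (k *: e) (dir (k *: e) f) x = k ^+ 2 * dir e (dir e f) x.
Proof.
move=> sf; rewrite -[k *: e]add0r dir2_expand// (dirC e 0 x sf) !dir0v; ring.
Qed.

Lemma dir3_scale f (k : R) e x : smooth f ->
  dir (k *: e) (dir (k *: e) (dir (k *: e) f)) x = k ^+ 3 * dir e (dir e (dir e f)) x.
Proof.
move=> sf; rewrite -[k *: e]add0r dir3_expand// (dir_commute e 0 sf).
rewrite (dirC e 0 x (smooth_dir 0 sf)) (dirC e 0 x (smooth_dir e sf)) !dir0v; ring.
Qed.

Lemma hessian_sym f x : smooth f -> (hessian f x)^T = hessian f x.
Proof.
move=> sf; apply/matrixP => i j; rewrite !mxE.
by have := dirC (basis_vec j) (basis_vec i) x sf; rewrite dir.unlock.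
Qed.

Lemma dir2_quadratic f x w : smooth f ->
  dir w (dir w f) x = (w^T *m hessian f x *m w) ord0 ord0.
Proof. by move=> sf; rewrite dir_hessian// !col_id. Qed.

(** In the constant, 10 is [2 + 8], from the two cutoff terms of [max_point_estimate]; the [r^3]
    term bounds the drift, and the outer 4 inverts the 1/4. *)
Lemma interior_estimate (u : 'cV[R]_n -> R) (a b : 'cV[R]_n) (c r m : R) :
  smooth u -> strictly_convex u ->
  (forall x, \det (hessian u x) = expR (- dir a u x + dotv b x + c)) ->
  0 < r -> 0 < m ->
  (forall x w, dotv x x <= r ^+ 2 -> m * dotv w w <= dir w (dir w u) x) ->
  forall x e, dotv x x <= r ^+ 2 ->
  (cutoff r x * dir e (dir e (dir e u)) x) ^+ 2 <=
    4 * (10 * n%:R * r ^+ 2 / m + r ^+ 3 * (1 + dotv a a)) * dir e (dir e u) x ^+ 3.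
Proof.
move=> su uconv u_sol r0 m0 um.
set C := 4 * _.
have aa0 := dotv_ge0 a.
have C0 : 0 <= C.
  rewrite /C mulr_ge0// addr_ge0//.
    by rewrite divr_ge0 ?(ltW m0)// mulr_ge0 ?sqr_ge0// mulr_ge0.
  by rewrite mulr_ge0 ?exprn_ge0 ?(ltW r0)// addr_ge0.
have H0 x w : w != 0 -> 0 < dir w (dir w u) x.
  by move=> w0; rewrite dir2_quadratic//; exact: uconv.
have H00 x w : 0 <= dir w (dir w u) x.
  by have [->|/(H0 x)/ltW//] := eqVneq w 0; rewrite dir0v.
pose K := [set x : 'cV[R]_n | dotv x x <= r ^+ 2] `*` [set e : 'cV[R]_n | dotv e e = 1].
pose D2 (z : 'cV[R]_n * 'cV[R]_n) := dir z.2 (dir z.2 u) z.1.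
pose D3 (z : 'cV[R]_n * 'cV[R]_n) := dir z.2 (dir z.2 (dir z.2 u)) z.1.
(* Numerator and denominator both have degree 6 in the direction, so unit directions suffice and the
   domain is compact. *)
pose G z := (cutoff r z.1 * D3 z) ^+ 2 / D2 z ^+ 3.
have K0 z : K z -> z.2 != 0.
  move=> [_ /= z2]; apply/eqP => z20; move: z2; rewrite z20 dotvr0 => /esym/eqP.
  by rewrite oner_eq0.
have cG : {within K, continuous G}.
  apply: continuous_in_subspaceT => z /[!inE] zK.
  have c3 : {for z, continuous D3} by exact: (@iter_dir_continuous R n 3 u su z).
  have c2 : {for z, continuous D2} by exact: (@iter_dir_continuous R n 2 u su z).
  have c1 : {for z, continuous (fun z : 'cV[R]_n * 'cV[R]_n => cutoff r z.1)}.
    apply: (@continuous_comp _ _ _ fst (cutoff r)); first exact: cvg_fst.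
    exact: (continuousB (@cst_continuous _ _ (r ^+ 2) z.1) (@dotv_continuous R n z.1)).
  have c13 := continuousM c1 c3.
  have c22 := continuousM c2 (continuousM c2 c2).
  have n0 : (D2 * (D2 * D2)) z != 0.
    by rewrite !mulf_neq0// gt_eqF//; exact: H0 (K0 _ zK).
  have := continuousM (continuousM c13 c13) (continuousV n0 c22).
  by [].
move=> x e xr; have [->|e0] := eqVneq e 0; first by rewrite !dir0v mulr0 !expr0n mulr0.
have [ke [e' [ke0 e'1 eE]]] := dotv_normalize e0.
have K_neq0 : K !=set0 by exists (x, e').
have [[x1 e1] /[!inE] K1 Gmax] := compact_EVT_max K_neq0 (@compact_ball_sphere R n (r ^+ 2)) cG.
set l := G (x1, e1) in Gmax.
have ratio y w : dotv y y <= r ^+ 2 ->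
    (cutoff r y * dir w (dir w (dir w u)) y) ^+ 2 <= l * dir w (dir w u) y ^+ 3.
  move=> yr; have [->|w0] := eqVneq w 0; first by rewrite !dir0v mulr0 !expr0n mulr0.
  have [k [w' [k0 w'1 ->]]] := dotv_normalize w0.
  have Kw : K (y, w') by [].
  have := Gmax (y, w'); rewrite inE => /(_ Kw).
  rewrite ler_pdivrMr ?exprn_gt0//; last exact: H0 (K0 _ Kw).
  rewrite /D2 /D3 /= (dir2_scale k w' y su) (dir3_scale k w' y su) => H.
  have := ler_wpM2l (sqr_ge0 (k ^+ 3)) H; congr (_ <= _); ring.
apply: le_trans (ratio x e xr) _; rewrite ler_wpM2r ?exprn_ge0//.
have [l0|l0] := leP l 0; first exact: le_trans l0 C0.
have [x1r e11] := K1.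
have D20 : 0 < D2 (x1, e1) by exact: H0 (K0 _ K1).
have c3n0 : cutoff r x1 * D3 (x1, e1) != 0.
  by apply: contraTneq l0 => E; rewrite /l /G E expr0n mul0r ltxx.
(* [G] vanishes where the cutoff does, so a positive maximum is attained at an interior point. *)
have c0 : 0 < cutoff r x1.
  rewrite lt_def subr_ge0 x1r andbT.
  by apply: contra_neq c3n0 => ->; rewrite mul0r.
have D30 : D3 (x1, e1) != 0 by apply: contra_neq c3n0 => ->; rewrite mulr0.
(* The square root normalizes [H(e2,e2)] to 1; the sign makes the cubic form, odd in the direction,
   positive. *)
pose k := Num.sg (D3 (x1, e1)) / Num.sqrt (D2 (x1, e1)).
have sq0 : 0 < Num.sqrt (D2 (x1, e1)) by rewrite sqrtr_gt0.
have k2 : k ^+ 2 * D2 (x1, e1) = 1.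
  rewrite expr_div_n sqr_sg D30 sqr_sqrtr ?(ltW D20)// mul1r mulVf// gt_eqF//.
pose e2 := k *: e1.
have E2 : dir e2 (dir e2 u) x1 = 1 by rewrite dir2_scale.
pose t := dir e2 (dir e2 (dir e2 u)) x1.
have k20 : 0 < k ^+ 2 by rewrite -(pmulr_lgt0 _ D20) k2.
have tE : t = k ^+ 3 * D3 (x1, e1) by exact: dir3_scale.
have t0 : 0 < t.
  rewrite tE exprSr -mulrA mulr_gt0// /k mulrAC -normrEsg divr_gt0// normr_gt0//.
have lE : l = (cutoff r x1 * t) ^+ 2.
  have lD : l * D2 (x1, e1) ^+ 3 = (cutoff r x1 * D3 (x1, e1)) ^+ 2.
    by rewrite /l /G divfK// expf_neq0// gt_eqF.
  transitivity (l * (k ^+ 2 * D2 (x1, e1)) ^+ 3); first by rewrite k2 expr1n mulr1.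
  by rewrite exprMn mulrCA lD tE; ring.
have [d d0 dP] : exists2 d, 0 < d & forall y, `|y - x1| < d -> dotv y y <= r ^+ 2.
  have h0 : 0 < cutoff r x1 by [].
  have /cvgrPdist_lt/(_ _ h0)/nbhs_ballP[d /= d0 H] := @dotv_continuous R n x1.
  exists d => // y yd; have := H y; rewrite -ball_normE/= distrC => /(_ yd).
  rewrite ltr_norml /cutoff => /andP[H1 _]; lra.
have [P PHP] := posdefmx_normalize (hessian_sym x1 su) (uconv x1).
have Hmax y w : `|y - x1| < d ->
    (cutoff r y * dir w (dir w (dir w u)) y) ^+ 2 <= l * dir w (dir w u) y ^+ 3.
  by move=> /dP; exact: ratio.
have := max_point_estimate su u_sol PHP (H00 x1) d0 Hmax E2 erefl t0 c0 lE.
rewrite -lE => est.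
have Pm i : dotv (col i P) (col i P) <= m^-1.
  rewrite -(ler_pM2l m0) mulfV ?gt_eqF//; apply: le_trans (um x1 (col i P) x1r) _.
  by rewrite (frame_orthonormal su PHP) eqxx.
have sV : \sum_i dotv (col i P) (col i P) <= n%:R * m^-1.
  by apply: (le_trans (ler_sum _ (fun i _ => Pm i))); rewrite sumr_const card_ord mulr_natl.
have sX : \sum_i dotv x1 (col i P) ^+ 2 <= n%:R * (r ^+ 2 * m^-1).
  have Xm i : dotv x1 (col i P) ^+ 2 <= r ^+ 2 * m^-1.
    by apply: (le_trans (dotv_cauchy_schwarz _ _)); apply: ler_pM => //; exact: dotv_ge0.
  by apply: (le_trans (ler_sum _ (fun i _ => Xm i))); rewrite sumr_const card_ord mulr_natl.
have cr : cutoff r x1 <= r ^+ 2 by rewrite /cutoff gerBl dotv_ge0.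
(* From [0 <= |x1 - r a|^2] and [|x1| <= r], after division by [r]. *)
have xa : 2 * dotv x1 a <= r * (1 + dotv a a).
  rewrite -(ler_pM2l r0); have := dotv_comb_sqr x1 a 1 r.
  by move: x1r => /= x1r; lra.
have V0 : 0 <= \sum_i dotv (col i P) (col i P) by apply: sumr_ge0 => i _; exact: dotv_ge0.
have p1 : cutoff r x1 * \sum_i dotv (col i P) (col i P) <= r ^+ 2 * (n%:R * m^-1).
  by apply: ler_pM => //; exact: ltW.
have p2 : cutoff r x1 * (2 * dotv x1 a) <= r ^+ 2 * (r * (1 + dotv a a)).
  apply: (@le_trans _ _ (cutoff r x1 * (r * (1 + dotv a a)))).
    by rewrite ler_wpM2l// ltW.
  by rewrite ler_wpM2r// mulr_ge0 ?(ltW r0)// addr_ge0.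
rewrite /C; lra.
Qed.

End InteriorEstimate.

(** * Growth of the Hessian and conclusion *)

Section Conclusion.
Context {R : realType} {n : nat}.
Implicit Types (f : 'cV[R]_n -> R) (x y v w e : 'cV[R]_n) (r : R).

(** At [s = - p / (1 + |q|)] the linear term outweighs the quadratic one, and the value is negative
    unless [p = 0]. *)
Lemma nonneg_quadratic_linear_term (p q : R) :
  (forall s, 0 <= s * p + s ^+ 2 * q) -> p = 0.
Proof.
move=> H; have q1 : 0 < 1 + `|q| by rewrite ltr_pwDl.
have := H (- p / (1 + `|q|)).
have -> : - p / (1 + `|q|) * p + (- p / (1 + `|q|)) ^+ 2 * q =
   p ^+ 2 * ((1 + `|q|) ^- 2) * (q - (1 + `|q|)) by field; rewrite gt_eqF.
have := ler_norm q => qq; apply: contraTeq => p0; rewrite -ltNge pmulr_rlt0; first by lra.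
have p2 : 0 < p ^+ 2 by rewrite exprn_even_gt0.
by rewrite mulr_gt0// invr_gt0 exprn_gt0.
Qed.

(** The Rayleigh quotient attains its minimum on the unit sphere, and the first-order condition
    makes the minimizer an eigenvector. The minimum is thus an eigenvalue, hence at least [mu]. *)
Lemma smallest_eigenvalue_le (M : 'M[R]_n) (mu : R) w : M^T = M ->
  is_smallest_eigenvalue M mu -> mu * dotv w w <= (w^T *m M *m w) ord0 ord0.
Proof.
move=> MT [_ mu_le].
have [->|w0] := eqVneq w 0; first by rewrite dotvr0 mulr0 mulmx0 mxE.
pose bl (v z : 'cV[R]_n) : R := (v^T *m M *m z) ord0 ord0.
have blC v z : bl v z = bl z v.
  have : (v^T *m M *m z)^T = z^T *m M *m v by rewrite !trmx_mul trmxK MT mulmxA.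
  by move=> /(congr1 (fun A : 'M[R]_1 => A ord0 ord0)); rewrite mxE.
have blD v z s : bl (v + s *: z) (v + s *: z) = bl v v + s * (2 * bl z v) + s ^+ 2 * bl z z.
  have -> : bl (v + s *: z) (v + s *: z) = bl v v + s * bl z v + s * (bl v z + s * bl z z).
    rewrite /bl !raddfD /= !linearZ /= !mulmxDl -!scalemxAl !mxE.
    by [].
  by rewrite (blC v z); ring.
have blZ k v : bl (k *: v) (k *: v) = k ^+ 2 * bl v v.
  by have := blD 0 v k; rewrite add0r => ->; rewrite /bl trmx0 !mul0mx mulmx0 !mxE; ring.
have cbl : continuous (fun v => bl v v).
  have -> : (fun v => bl v v) = fun v => \sum_i \sum_j M j i * (v j ord0 * v i ord0).
    apply/funext => v; rewrite /bl mxE; apply: eq_bigr => i _; rewrite mxE mulr_suml.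
    by apply: eq_bigr => j _; rewrite !mxE; ring.
  do 2 apply: continuous_bigsum => ?; apply: continuous_mul.
    by move=> ?; exact: cst_continuous.
  by apply: continuous_mul; exact: coord_continuous.
have [k [e [k0 e1 wE]]] := dotv_normalize w0.
have S0 : [set e : 'cV[R]_n | dotv e e = 1] !=set0 by exists e.
have [v /[!inE] v1 vmin] := compact_EVT_min S0 compact_sphere (continuous_subspaceT cbl).
have {}vmin z : bl v v * dotv z z <= bl z z.
  have [->|z0] := eqVneq z 0; first by rewrite dotvr0 mulr0 /bl mulmx0 mxE.
  have [l [z' [l0 z'1 ->]]] := dotv_normalize z0.
  rewrite blZ dotvZ z'1 mulr1 mulrC ler_wpM2l ?sqr_ge0//.
  by apply: vmin; rewrite inE.
have crit z : bl z v = bl v v * dotv z v.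
  apply/eqP; rewrite -subr_eq0; apply/eqP.
  suff : 2 * (bl z v - bl v v * dotv z v) = 0 by lra.
  apply: (@nonneg_quadratic_linear_term _ (bl z z - bl v v * dotv z z)) => s.
  have := vmin (v + s *: z); rewrite blD.
  have -> : dotv (v + s *: z) (v + s *: z) = dotv v v + s * (2 * dotv z v) + s ^+ 2 * dotv z z.
    rewrite /dotv !mulr_sumr -!big_split /=.
    by apply: eq_bigr => i _; rewrite !mxE; ring.
  by move: v1 => /= -> H; lra.
have Mv : M *m v = bl v v *: v.
  apply/colP => i; have := crit (delta_mx i ord0).
  rewrite /bl trmx_delta -mulmxA -rowE mxE => ->.
  rewrite [RHS]mxE; congr (_ * _); rewrite /dotv (bigD1 i)//= big1 => [|j ji].
    by rewrite [delta_mx _ _ _ _]mxE !eqxx mul1r addr0.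
  by rewrite [delta_mx _ _ _ _]mxE (negbTE ji) mul0r.
have ev : eigenvalue M (bl v v).
  (* [eigenvalue] is about row vectors, hence the transpose and the symmetry of [M]. *)
  apply/eigenvalueP; exists v^T; first by rewrite -{1}MT -trmx_mul Mv linearZ.
  apply/eqP => /(congr1 trmx); rewrite trmxK trmx0 => v0.
  by move: v1; rewrite v0 /= dotvr0 => /esym/eqP; rewrite oner_eq0.
apply: le_trans (vmin w); rewrite ler_wpM2r ?dotv_ge0//; exact: mu_le.
Qed.

Lemma limf_einf_at_infinity_gt (f : 'cV[R]_n -> \bar R) (k : \bar R) :
  (k < limf_einf f at_infinity)%E ->
  exists r : R, forall x, r < enorm x -> (k < f x)%E.
Proof.
rewrite limf_einfE => /ereal_sup_gt[_ [A [r Ar] <-] kA].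
exists r => x /Ar Ax; apply: (lt_le_trans kA); apply: ereal_inf_lbound.
by exists x.
Qed.

Lemma enormE x : enorm x = Num.sqrt (dotv x x).
Proof. by congr Num.sqrt; apply: eq_bigr => i _; rewrite expr2. Qed.

(** For [|r0| < |x| <= r] the growth condition gives [mu x > k / |x| >= k / r]. On the remaining
    ball, compactness gives a positive minimum [m] of [H] on unit vectors, and [r >= k / m]
    suffices. The vector [e0] witnesses that the unit sphere is nonempty. *)
Lemma hessian_lower_bound (u : 'cV[R]_n -> R) (mu : 'cV[R]_n -> R) (k r0 : R) e0 :
  dotv e0 e0 = 1 -> smooth u -> strictly_convex u ->
  (forall x, is_smallest_eigenvalue (hessian u x) (mu x)) ->
  0 < k -> (forall x, r0 < enorm x -> k < enorm x * mu x) ->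
  exists2 r1, 0 < r1 & forall r, r1 <= r -> forall x w, dotv x x <= r ^+ 2 ->
    k / r * dotv w w <= dir w (dir w u) x.
Proof.
move=> e01 su uconv muP k0 muk.
have H0 x w : w != 0 -> 0 < dir w (dir w u) x.
  by move=> w0; rewrite dir2_quadratic//; exact: uconv.
pose K := [set x : 'cV[R]_n | dotv x x <= r0 ^+ 2] `*` [set e : 'cV[R]_n | dotv e e = 1].
have K0 : K !=set0.
  by exists (0, e0); split=> //=; rewrite dotvr0 sqr_ge0.
have cD : {within K, continuous (fun z : 'cV[R]_n * 'cV[R]_n => dir z.2 (dir z.2 u) z.1)}.
  by apply: continuous_subspaceT; exact: (@iter_dir_continuous R n 2 u su).
have [[x1 e1] /[!inE] K1 Dmin] := compact_EVT_min K0 (@compact_ball_sphere R n _) cD.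
have [_ /= e11] := K1.
set m := dir _ _ _ in Dmin.
have m0 : 0 < m.
  apply: H0 => /=; apply/eqP => e10; move: e11; rewrite e10 dotvr0 => /esym/eqP.
  by rewrite oner_eq0.
have r10 : 0 < k / m + `|r0| + 1 by rewrite ltr_wpDl// addr_ge0// divr_ge0// ltW.
exists (k / m + `|r0| + 1) => // r rr.
have km : 0 < k / m by rewrite divr_gt0.
have rk : k / m <= r by have := normr_ge0 r0; lra.
have r_gt0 : 0 < r by exact: lt_le_trans km rk.
move=> x w xr; have [->|w0] := eqVneq w 0; first by rewrite dotvr0 mulr0 dir0v.
have [x0|x0] := leP (dotv x x) (r0 ^+ 2).
  have [l [w' [l0 w'1 ->]]] := dotv_normalize w0.
  rewrite (dir2_scale l w' x su) dotvZ w'1 mulr1 mulrC ler_wpM2l ?sqr_ge0//.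
  have Kx : K (x, w') by [].
  have := Dmin (x, w'); rewrite inE => /(_ Kx) /=; apply: le_trans.
  by rewrite ler_pdivrMr// mulrC -ler_pdivrMr.
have xn : r0 < enorm x.
  rewrite enormE; apply: (le_lt_trans (ler_norm r0)); rewrite -sqrtr_sqr.
  by rewrite ltr_sqrt// (le_lt_trans (sqr_ge0 r0) x0).
have xle : enorm x <= r by rewrite enormE -(ger0_norm (ltW r_gt0)) -sqrtr_sqr ler_wsqrtr.
have x_ge0 : 0 <= enorm x by exact: sqrtr_ge0.
have kx := muk _ xn.
have mu0 : 0 < mu x by rewrite ltNge; apply/negP => mu0; nra.
rewrite dir2_quadratic//.
apply: le_trans (smallest_eigenvalue_le _ (hessian_sym x su) (muP x)).
rewrite ler_wpM2r ?dotv_ge0// ler_pdivrMr// (le_trans (ltW kx))// mulrC.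
by rewrite ler_wpM2l ?(ltW mu0).
Qed.

Lemma third_derivative_eq0 (u : 'cV[R]_n -> R) (a b : 'cV[R]_n) (c k r1 : R) :
  smooth u -> strictly_convex u ->
  (forall x, \det (hessian u x) = expR (- dir a u x + dotv b x + c)) ->
  0 < k -> 0 < r1 ->
  (forall r, r1 <= r -> forall x w, dotv x x <= r ^+ 2 ->
    k / r * dotv w w <= dir w (dir w u) x) ->
  forall x e, dir e (dir e (dir e u)) x = 0.
Proof.
move=> su uconv u_sol k0 r10 uk x e.
pose T := dir e (dir e (dir e u)) x; pose H := dir e (dir e u) x.
have H0 : 0 <= H.
  rewrite /H; have [->|e0] := eqVneq e 0; first by rewrite dir0v.
  by rewrite dir2_quadratic// ltW//; exact: uconv.
pose C := 4 * (10 * n%:R / k + (1 + dotv a a)) * H ^+ 3.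
have C0 : 0 <= C.
  rewrite /C mulr_ge0 ?exprn_ge0// mulr_ge0// addr_ge0//.
    by rewrite divr_ge0 ?(ltW k0)// mulr_ge0.
  by rewrite addr_ge0// dotv_ge0.
have bound r : r1 <= r -> 2 * dotv x x <= r ^+ 2 -> r * T ^+ 2 <= 4 * C.
  move=> rr xr; have r0 : 0 < r by exact: lt_le_trans rr.
  have xr' : dotv x x <= r ^+ 2 by have := dotv_ge0 x; lra.
  have kr0 : 0 < k / r by rewrite divr_gt0.
  have := @interior_estimate R n u a b c r (k / r) su uconv u_sol r0 kr0 (uk r rr) x e xr'.
  rewrite -/T -/H => est.
  (* With [m = k / r] both parts of the constant scale like [r^3]. *)
  have E : 4 * (10 * n%:R * r ^+ 2 / (k / r) + r ^+ 3 * (1 + dotv a a)) * H ^+ 3 = r ^+ 3 * C.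
    by rewrite /C; field; rewrite !gt_eqF.
  rewrite E in est.
  have h : (r ^+ 2 / 2) ^+ 2 <= cutoff r x ^+ 2.
    rewrite ler_pXn2r// ?nnegrE ?divr_ge0 ?sqr_ge0//; rewrite /cutoff; have := dotv_ge0 x; lra.
  have h2 : (r ^+ 2 / 2) ^+ 2 * T ^+ 2 <= r ^+ 3 * C.
    by apply: le_trans est; rewrite [leRHS]exprMn ler_wpM2r// sqr_ge0.
  rewrite -(ler_pM2l (exprn_gt0 3 r0)); lra.
apply/eqP; rewrite -/T -sqrf_eq0; apply/negPn/negP => T0.
have T1 : 0 < T ^+ 2 by rewrite lt_def T0 sqr_ge0.
(* The summands [1 + 2 * dotv x x] ensure [2 * dotv x x <= r <= r^2]; the last one makes
   [r * T ^+ 2] exceed [4 * C], against [bound]. *)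
pose r := r1 + 1 + 2 * dotv x x + (4 * C) / T ^+ 2.
have q0 : 0 <= 4 * C / T ^+ 2 by rewrite divr_ge0 ?sqr_ge0// mulr_ge0.
have x0 := dotv_ge0 x.
have [] : r1 <= r /\ 2 * dotv x x <= r ^+ 2.
  have rx : 1 + 2 * dotv x x <= r by rewrite /r; lra.
  split; first by rewrite /r; lra.
  nra.
move=> h1 h2; have := bound r h1 h2; rewrite leNgt => /negP; apply.
rewrite -ltr_pdivrMr// /r; lra.
Qed.

(** Taylor expansion on the segment from 0 to [x] in the direction [x] itself meets only the values
    [D^3 u(x,x,x)], so no polarization is called for. *)
Lemma quadratic_of_third_derivative (u : 'cV[R]_n -> R) : smooth u ->
  (forall x e, dir e (dir e (dir e u)) x = 0) ->
  forall x, u x = u 0 + dir x u 0 + 2^-1 * dir x (dir x u) 0.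
Proof.
move=> su u3 x.
have SD (w : 'cV[R]_n) (f : 'cV[R]_n -> R) : smooth f -> smooth (dir w f)
  by exact: smooth_dir.
have L (f : 'cV[R]_n -> R) s : smooth f ->
    is_derive s (1 : R) (fun s => f (0 + s *: x)) (dir x f (0 + s *: x)).
  by move=> sf; exact: is_derive_dir_line.
have I s : is_derive s (1 : R) (fun t : R => t) 1 by exact: is_derive_id.
have K (k : R) s : is_derive s (1 : R) (fun _ : R => k) 0 by exact: is_derive_cst.
set h := dir x (dir x u) 0; set g := dir x u 0.
have c2 s : dir x (dir x u) (0 + s *: x) = h.
  have := @is_derive_0_is_cst R (fun s => dir x (dir x u) (0 + s *: x)) s 0.
  rewrite scale0r addr0; apply => t.
  by apply: is_derive_eq (L _ t (SD _ _ (SD _ _ su))) _; exact: u3.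
have c1 s : dir x u (0 + s *: x) = g + s * h.
  have D t : is_derive t (1 : R) (fun s => dir x u (0 + s *: x) + s * - h) 0.
    apply: is_derive_eq (is_deriveD_fun (L _ t (SD _ _ su))
      (is_deriveM_fun (I t) (K (- h) t))) _.
    by rewrite c2; ring.
  have := is_derive_0_is_cst s 0 D; rewrite scale0r addr0 mul0r addr0 -/g => <-; ring.
have D t : is_derive t (1 : R) (fun s => u (0 + s *: x) + s * (- g + s * - (h / 2))) 0.
  apply: is_derive_eq (is_deriveD_fun (L _ t su)
    (is_deriveM_fun (I t) (is_deriveD_fun (K (- g) t) (is_deriveM_fun (I t) (K (- (h / 2)) t))))) _.
  by rewrite c1; field.
have := is_derive_0_is_cst 1 0 D.
by rewrite scale1r scale0r !addr0 !mul0r addr0 add0r => <-; lra.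
Qed.

End Conclusion.

Theorem theorem1p1 (R : realType) (n : nat) (n_ge2 : (2 <= n)%N)
  (a b : 'cV[R]_n) (a_neq0 : enorm a != 0) (b_neq0 : enorm b != 0) (c : R)
  (u : 'cV[R]_n -> R) (u_smooth : smooth u) (u_convex : strictly_convex u)
  (u_sol : forall x : 'cV[R]_n,
     \det (hessian u x) =
     expR (- (\sum_(i < n) a i ord0 * partial i u x)
           + \sum_(i < n) b i ord0 * x i ord0 + c))
  (A : 'M[R]_n) (A_orth : orthogonal_matrix A)
  (lA : nat) (lAP : is_lmin A lA) (lA_ge3 : (3 <= lA)%N)
  (u_inv : forall x : 'cV[R]_n, u (A *m x) = u x)
  (mu : 'cV[R]_n -> R)
  (muP : forall x : 'cV[R]_n, is_smallest_eigenvalue (hessian u x) (mu x))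
  (mu_liminf :
     (((n%:R - 1) / (enorm a * cos (pi / lA%:R)))%:E <
       limf_einf (fun x : 'cV[R]_n => (enorm x * mu x)%:E) at_infinity)%E) :
  quadratic_polynomial u.
Proof.
have a0 : a != 0 by apply: contra_neq a_neq0 => ->; rewrite enormE dotvr0 sqrtr0.
have [_ [e0 [_ e01 _]]] := dotv_normalize a0.
(* [3 <= lA] puts [pi / lA] strictly between 0 and [pi / 2], where the cosine is positive. *)
have k0 : 0 < (n%:R - 1) / (enorm a * cos (pi / lA%:R)).
  rewrite divr_gt0//; first by rewrite subr_gt0 ltr1n.
  rewrite mulr_gt0//; first by rewrite lt_def a_neq0 enormE sqrtr_ge0.
  have l3 : (3 : R) <= lA%:R by rewrite ler_nat.
  have pi0 := pi_gt0 R.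
  apply: cos_gt0_pihalf; apply/andP; split.
    apply: (@lt_trans _ _ 0); first by rewrite oppr_lt0 divr_gt0.
    by rewrite divr_gt0//; lra.
  by rewrite ltr_pM2l// ltf_pV2 ?posrE//; lra.
have [r0 mur] := limf_einf_at_infinity_gt mu_liminf.
have {}mur x : r0 < enorm x -> (n%:R - 1) / (enorm a * cos (pi / lA%:R)) < enorm x * mu x.
  by move=> /mur; rewrite lte_fin.
have {}u_sol x : \det (hessian u x) = expR (- dir a u x + dotv b x + c).
  by rewrite u_sol dirE.
have [r1 r10 uk] := hessian_lower_bound e01 u_smooth u_convex muP k0 mur.
have u3 := third_derivative_eq0 u_smooth u_convex u_sol k0 r10 uk.
have uE := quadratic_of_third_derivative u_smooth u3.
exists (2^-1 *: hessian u 0), (\col_i partial i u 0), (u 0); split.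
- by rewrite linearZ /= hessian_sym.
(* The matrix is nonzero because strict convexity at 0 makes its quadratic form positive on [e0]. *)
- apply/eqP => /(congr1 (fun Q => (e0^T *m Q *m e0) ord0 ord0)).
  rewrite mulmx0 mul0mx -scalemxAr -scalemxAl !mxE => /eqP; rewrite mulf_eq0 invr_eq0.
  have e00 : e0 != 0 by apply/eqP => E; move: e01; rewrite E dotvr0 => /esym/eqP; rewrite oner_eq0.
  by have := u_convex 0 e0 e00; rewrite mxE => /lt0r_neq0/negbTE ->; rewrite pnatr_eq0.
move=> x; rewrite uE dir2_quadratic// dirE// -scalemxAr -scalemxAl [in RHS]mxE.
rewrite /dotv; under [X in _ = _ + X + _]eq_bigr do rewrite mxE mulrC.
by rewrite addrC (addrC (u 0)) addrA.
Qed.
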